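(* Let $(A,B,C,D)$ be a minimal state-space realization of a discrete-time, symmetric, real, rational, proper transfer function $G(z)$. Suppose $\det(I+A)\ne0$ and $\det(I-A)\ne0$. Then $G(z)$ is D-NI if and only if $D=D^\top$ and there exists a real matrix $X=X^\top>0$ such that $$X-A^\top X A\ge0\quad\text{and}\quad C=-B^\top(A^\top-I)^{-1}X(A+I).$$
   Context: A (real) state-space realization $(A,B,C,D)$ of $G$ consists of real matrices with $G(z)=C(zI-A)^{-1}B+D$; it is minimal if the dimension of $A$ is smallest possible (equivalently, reachable and observable). $i$ is the imaginary unit; $M^*$ is the conjugate transpose and $M^\top$ the transpose; $\ge0$ and $>0$ (likewise $\le0$) denote positive semidefiniteness and positive definiteness of Hermitian matrices. A rational transfer function $G:\mathbb{C}\to\mathbb{C}^{m\times m}$ is real if its entries are rational functions with real coefficients, symmetric if $G(z)=G(z)^\top$, and proper if $G(\infty)$ is finite. D-NI (discrete negative imaginary): a real transfer function $G$ that is analytic in $\{|z|>1\}$ and such that, for all $z$ with $|z|>1$: $i[G(z)-G(z)^*]\ge0$ if $\mathrm{Im}\,z>0$; $i[G(z)-G(z)^*]=0$ if $\mathrm{Im}\,z=0$; $i[G(z)-G(z)^*]\le0$ if $\mathrm{Im}\,z<0$. *)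

(* Defs.v *)
From HB Require Import structures.
From mathcomp Require Import all_boot all_order all_algebra.
From mathcomp Require Import spectral sesquilinear.
From mathcomp Require Import complex.
From mathcomp Require Import boolp classical_sets reals topology normedtype derive.
Set Implicit Arguments.
Unset Strict Implicit.
Unset Printing Implicit Defensive.
Import Order.TTheory GRing.Theory Num.Theory.
Import numFieldNormedType.Exports.
Local Open Scope ring_scope.
Local Open Scope complex_scope.
Local Open Scope sesquilinear_scope.

(* Rational functions with real coefficients are elements of
   {fraction {poly R}}. The representative [repr f] need not be in lowest terms,
   hence the division by the gcd, without which a removable singularity would
   count as a pole. *)
Definition rnum (R : realType) (f : {fraction {poly R}}) : {poly R} :=
  \n_(repr f) %/ gcdp \n_(repr f) \d_(repr f).

Definition rden (R : realType) (f : {fraction {poly R}}) : {poly R} :=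
  \d_(repr f) %/ gcdp \n_(repr f) \d_(repr f).

Definition pole (R : realType) (f : {fraction {poly R}}) (z : R[i]) : bool :=
  root (map_poly (real_complex R) (rden f)) z.

(* Meaningful only where z is not a pole of f; the value is 0 at a pole. *)
Definition reval (R : realType) (f : {fraction {poly R}}) (z : R[i]) : R[i] :=
  (map_poly (real_complex R) (rnum f)).[z] /
  (map_poly (real_complex R) (rden f)).[z].

Definition mxreval (R : realType) (p q : nat)
    (G : 'M[{fraction {poly R}}]_(p, q)) (z : R[i]) : 'M[R[i]]_(p, q) :=
  \matrix_(i, j) reval (G i j) z.

(* Complex differentiability at every point of the (open) set U; the absence of
   poles is required separately because [reval] is total. *)
Definition analytic_on (R : realType) (p q : nat)
    (G : 'M[{fraction {poly R}}]_(p, q)) (U : R[i] -> Prop) : Prop :=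
  forall i j z, U z ->
    ~~ pole (G i j) z /\
    derivable (reval (G i j) : R[i]^o -> R[i]^o) z 1.

(* G(z) converges to a finite limit as |z| tends to infinity. *)
Definition proper_rat (R : realType) (p q : nat)
    (G : 'M[{fraction {poly R}}]_(p, q)) : Prop :=
  forall i j, exists l : R[i], forall e : R, 0 < e ->
    exists M : R, forall z : R[i], M%:C < `|z| ->
      `|reval (G i j) z - l| < e%:C.

Definition psdmx (R : realType) (n : nat) (M : 'M[R[i]]_n) : Prop :=
  M \is hermsymmx /\ forall v : 'cV[R[i]]_n, 0 <= (v ^t* *m M *m v) 0 0.

Definition pdmx (R : realType) (n : nat) (M : 'M[R[i]]_n) : Prop :=
  M \is hermsymmx /\
  forall v : 'cV[R[i]]_n, v != 0 -> 0 < (v ^t* *m M *m v) 0 0.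

(* M <= 0 is expressed as - M >= 0. *)
Definition D_NI (R : realType) (m : nat)
    (G : 'M[{fraction {poly R}}]_m) : Prop :=
  analytic_on G (fun z => 1 < `|z|) /\
  forall z : R[i], 1 < `|z| ->
    let H := 'i *: (mxreval G z - (mxreval G z) ^t*) in
    [/\ 0 < 'Im z -> psdmx H,
        'Im z = 0 -> H = 0
      & 'Im z < 0 -> psdmx (- H)].

Definition cst_rat (R : realType) (a : R) : {fraction {poly R}} :=
  FracField.tofrac a%:P.

(* G(z) = C (z I - A)^{-1} B + D as an identity of rational matrices;
   z I - A is always invertible over the field of rational functions. *)
Definition realization (R : realType) (m n : nat)
    (A : 'M[R]_n) (B : 'M[R]_(n, m)) (C : 'M[R]_(m, n)) (D : 'M[R]_m)
    (G : 'M[{fraction {poly R}}]_m) : Prop :=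
  G = map_mx (@cst_rat R) C
        *m invmx ((FracField.tofrac 'X)%:M - map_mx (@cst_rat R) A)
        *m map_mx (@cst_rat R) B
      + map_mx (@cst_rat R) D.

Definition minimal_realization (R : realType) (m n : nat)
    (A : 'M[R]_n) (B : 'M[R]_(n, m)) (C : 'M[R]_(m, n)) (D : 'M[R]_m)
    (G : 'M[{fraction {poly R}}]_m) : Prop :=
  realization A B C D G /\
  forall (n' : nat) (A' : 'M[R]_n') (B' : 'M[R]_(n', m)) (C' : 'M[R]_(m, n'))
         (D' : 'M[R]_m),
    realization A' B' C' D' G -> (n <= n')%N.

Definition cmx (R : realType) (p q : nat) (M : 'M[R]_(p, q)) : 'M[R[i]]_(p, q) :=
  map_mx (real_complex R) M.

(* Main.v *)
Require Import Defs.
From mathcomp Require Import all_boot all_order all_algebra.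
From mathcomp Require Import spectral sesquilinear.
From mathcomp Require Import cyclic separable cyclotomic complex polyrcf.
From mathcomp Require Import generic_quotient zify ring lra.
From mathcomp Require Import boolp classical_sets functions reals topology.
From mathcomp Require Import normedtype sequences derive.
Set Implicit Arguments.
Unset Strict Implicit.
Unset Printing Implicit Defensive.
Import Order.TTheory GRing.Theory Num.Theory.
Local Open Scope ring_scope.
Import numFieldNormedType.Exports.

(** Put b = (A - I)^-1 B, and call X - A^T X A >= 0 the Stein inequality.

    Sufficiency. Since G is symmetric and the realization minimal, a symmetric
    invertible T satisfies T A = A^T T and T B = C^T ([symmetrizer_exists]).
    Then M = T (A - I) (A + I)^-1 is a symmetric form for which A is
    self-adjoint, and the equation for C says that M b = - X b. For a vector u
    and p = (zI - A)^-1 b u the form u^* i (G(z) - G(z)^* ) u equals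
    2 Im z . p^* (A^T M A - M) p ([NI_form_identity]), so the last factor must
    be nonnegative for |z| > 1. The Stein inequality says that A is a
    contraction for X. Diagonalizing X and M together, A is also a contraction
    for the absolute value |M| of M relative to X ([contraction_abs]). Splitting
    p along the positive and negative parts of M, the positive part of A p is z
    times that of p, because (z - A) p = b u lies in the negative part. This
    gives p^* (A^T M A - M) p = 2 (|z|^2 - 1) |p_+|^2 + |p|^2 - |A p|^2, with
    norms taken in |M|, and both differences are nonnegative.

    Necessity. By minimality the eigenvalues of A are poles of G, so they lie in
    the closed unit disc ([eigenvalue_pole]). Take a finite input w with
    transform u(z). The quantity (z - z^* ) u^* (G - G^* ) u is nonnegative for
    |z| = r > 1. Its mean over the circle, computed with roots of unity, is twice
    a weighted energy of w ([avg_energy]), which is a polynomial in r. Letting r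
    tend to 1, the system absorbs a nonnegative energy
    sum_k w_k^T C (x_(k+1) - x_(k-1)) from every finite input ([NI_passive]).
    The least energy needed to reach a given state and last input is then a
    nonnegative quadratic form that satisfies a dissipation inequality
    ([required_supply]). In the coordinate y = x + b w only the increments v of
    w matter, which leaves a form q with
    q(A y + b v) <= q(y) - v^T C (A y + b v + y) ([storage_incremental]). For
    v = 0 this is the Stein inequality. Where b v = - (A + I) y it is an
    equality, and its first variation there is the equation for C
    ([storage_output]). Observability makes X definite, and symmetry of G gives
    D = D^T ([symmetric_markov]). *)

(** * Rational functions and resolvents *)

Section RationalMatrices.
Variable R : realType.
Local Notation F := {fraction {poly R}}.
Local Notation frac := (@FracField.tofrac {poly R}).

Lemma numden_repr (f : F) : f * frac \d_(repr f) = frac \n_(repr f).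
Proof.
rewrite -{1}[f]reprK; case: (repr f) => -[a b] /= b0.
apply/eqP; rewrite !piE /FracField.equivf.
rewrite !numden_Ratio ?mulf_neq0 ?oner_eq0 //=.
by rewrite !mulr1 mulrC.
Qed.

Lemma rnum_rden_coprime (f : F) : coprimep (rnum f) (rden f).
Proof. by apply: coprimep_div_gcd; rewrite denom_ratioP orbT. Qed.

Lemma rnumden (f : F) : f * frac (rden f) = frac (rnum f).
Proof.
have := numden_repr f.
rewrite -{1}(divpK (dvdp_gcdl \n_(repr f) \d_(repr f))).
rewrite -{1}(divpK (dvdp_gcdr \n_(repr f) \d_(repr f))) -/(rnum f) -/(rden f).
rewrite !rmorphM /= mulrA; apply: mulIf.
by rewrite tofrac_eq0 gcdp_eq0 negb_and denom_ratioP orbT.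
Qed.

(** Since numerator and denominator are coprime, every denominator of f is a
    multiple of [rden f]; poles and values can thus be read off from any
    representation of f as a quotient. *)
Lemma rden_dvd (f : F) (a b : {poly R}) :
  f * frac b = frac a -> rden f %| b /\ rnum f * b = a * rden f.
Proof.
move=> fba.
have e : rnum f * b = a * rden f.
  apply/eqP; rewrite -tofrac_eq !rmorphM /= -rnumden -fba.
  by rewrite mulrAC.
have cop : coprimep (rden f) (rnum f) by rewrite coprimep_sym rnum_rden_coprime.
by split=> //; rewrite -(Gauss_dvdpr _ cop) e dvdp_mull.
Qed.

Section Evaluation.
Variables (f : F) (a b : {poly R}) (z : R[i]).
Hypothesis fba : f * frac b = frac a.
Hypothesis bz : (map_poly (real_complex R) b).[z] != 0.

Lemma pole_frac : ~~ pole f z.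
Proof.
have [/dvdpP [q bq] _] := rden_dvd fba.
apply: contraNN bz; rewrite /pole bq rmorphM hornerM /root => /eqP ->.
by rewrite mulr0.
Qed.

Lemma reval_frac :
  reval f z =
  (map_poly (real_complex R) a).[z] / (map_poly (real_complex R) b).[z].
Proof.
have [_ e] := rden_dvd fba; have p := pole_frac.
rewrite /reval; apply/eqP; rewrite eqr_div //; apply/eqP.
by rewrite -!hornerM -!rmorphM e.
Qed.

End Evaluation.

Lemma size_signr k (p : {poly R}) : size ((-1) ^+ k * p) = size p.
Proof.
by rewrite -signr_odd; case: odd; rewrite ?expr0 ?expr1 ?mul1r ?mulN1r ?size_polyN.
Qed.

Lemma map_frac_inj p q : injective (map_mx frac : 'M_(p, q) -> 'M_(p, q)).
Proof.
move=> P Q /matrixP e; apply/matrixP=> i j; apply/eqP; rewrite -tofrac_eq.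
by have := e i j; rewrite [LHS]mxE [RHS]mxE => ->.
Qed.

Section Resolvent.
Variable n : nat.
Implicit Type A : 'M[R]_n.

Definition pencil A : 'M[F]_n :=
  (frac 'X)%:M - map_mx (@cst_rat R) A.

Lemma pencilE A : pencil A = map_mx frac (char_poly_mx A).
Proof.
rewrite /pencil /char_poly_mx map_mxB map_scalar_mx; congr (_ - _).
by apply/matrixP=> i j; rewrite !mxE.
Qed.

Lemma char_poly_neq0 A : char_poly A != 0.
Proof. by rewrite monic_neq0 // char_poly_monic. Qed.

Lemma pencil_unit A : pencil A \in unitmx.
Proof.
by rewrite unitmxE pencilE det_map_mx unitfE tofrac_eq0 char_poly_neq0.
Qed.

Lemma invmx_pencil A :
  frac (char_poly A) *: invmx (pencil A) = map_mx frac (\adj (char_poly_mx A)).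
Proof.
apply: (can_inj (mulmxK (pencil_unit A))); rewrite -scalemxAl mulVmx ?pencil_unit //.
by rewrite pencilE -map_mxM /= mul_adj_mx map_scalar_mx scalemx1.
Qed.

(** A cofactor of zI - A is a minor of order n - 1 with entries of degree at
    most 1. *)
Lemma size_adj_char A (i j : 'I_n) : (size (\adj (char_poly_mx A) i j)%R <= n)%N.
Proof.
rewrite mxE /cofactor size_signr; set D := \det _.
have sle k l : (size (char_poly_mx A k l) <= 2)%N.
  rewrite !mxE (leq_trans (size_polyD _ _)) // geq_max.
  rewrite size_polyN (leq_trans (size_polyC_leq1 _)) // andbT.
  by rewrite mulrb; case: eqP => _; rewrite ?size_polyX ?size_poly0.
rewrite /D (leq_trans (size_sum _ _ _)) //; apply/bigmax_leqP=> s _.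
rewrite size_signr.
rewrite (leq_trans (size_poly_prod_leq _ _)) // card_ord leq_subLR.
apply: (@leq_trans (\sum_(k < n.-1) 2).+1).
  by rewrite ltnS; apply: leq_sum => k _; rewrite mxE mxE; exact: sle.
rewrite sum_nat_const card_ord.
by have := ltn_ord i; lia.
Qed.

(** The characteristic polynomial has degree exactly n, so it cannot divide a
    nonzero polynomial of smaller degree. This is the algebraic form of strict
    properness. *)
Lemma char_poly_dvd_small A p q (N P : 'M[{poly R}]_(p, q)) :
  (forall i j, (size (N i j) <= n)%N) -> N = char_poly A *: P -> P = 0.
Proof.
move=> sN e; apply/matrixP=> i j; rewrite [RHS]mxE; apply/eqP.
apply: contraT => P0; have := sN i j.
rewrite e mxE mulrC size_Mmonic ?char_poly_monic // size_char_poly /=.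
move: P0; rewrite -size_poly_gt0; move: (size _) => d d0 dn; exfalso; lia.
Qed.

Section Numerator.
Variables (p q : nat) (K : 'M[R]_(p, n)) (A : 'M[R]_n).
Implicit Type L : 'M[R]_(n, q).

(** Numerator of K (zI - A)^-1 L over the characteristic polynomial of A. *)
Definition resnum L : 'M[{poly R}]_(p, q) :=
  map_mx polyC K *m \adj (char_poly_mx A) *m map_mx polyC L.

Lemma map_cst_rat r s (M : 'M[R]_(r, s)) :
  map_mx (@cst_rat R) M = map_mx frac (map_mx polyC M).
Proof. by apply/matrixP=> i j; rewrite !mxE. Qed.

Lemma resnumE L :
  frac (char_poly A) *:
    (map_mx (@cst_rat R) K *m invmx (pencil A) *m map_mx (@cst_rat R) L)
  = map_mx frac (resnum L).
Proof.
by rewrite !map_mxM -!map_cst_rat -invmx_pencil scalemxAl scalemxAr.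
Qed.

Lemma size_resnum L i j : (size (resnum L i j) <= n)%N.
Proof.
rewrite mxE (leq_trans (size_sum _ _ _)) //; apply/bigmax_leqP=> k _.
rewrite mulrC [X in X * _]mxE mul_polyC.
rewrite (leq_trans (size_scale_leq _ _)) //.
rewrite mxE (leq_trans (size_sum _ _ _)) //; apply/bigmax_leqP=> l _.
by rewrite [X in X * _]mxE mul_polyC (leq_trans (size_scale_leq _ _)) // size_adj_char.
Qed.

(** From (zI - A)^-1 A = z (zI - A)^-1 - I. It lets Markov parameters be
    extracted one at a time by comparing degrees. *)
Lemma resnum_shift L :
  resnum (A *m L) = 'X *: resnum L - char_poly A *: map_mx polyC (K *m L).
Proof.
rewrite /resnum !map_mxM /=.
have -> : map_mx polyC A = 'X%:M - char_poly_mx A by rewrite opprB addrC subrK.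
rewrite mulmxBl mulmxBr; congr (_ - _); first by rewrite mul_scalar_mx scalemxAr.
rewrite !mulmxA -(mulmxA _ (\adj _)) mul_adj_mx -/(char_poly A).
by rewrite mul_mx_scalar !scalemxAl.
Qed.

(** A resolvent is strictly proper, so it is a polynomial only when it
    vanishes, and then all its Markov parameters vanish as well. *)
Lemma resolvent_poly L (P : 'M[{poly R}]_(p, q)) :
  map_mx (@cst_rat R) K *m invmx (pencil A) *m map_mx (@cst_rat R) L
    = map_mx frac P ->
  P = 0 /\ forall k, K *m (A ^+ k *m L) = 0.
Proof.
move=> e; have e1 : resnum L = char_poly A *: P.
  by apply: map_frac_inj; rewrite -resnumE e map_mxZ.
have P0 := char_poly_dvd_small (size_resnum L) e1; split=> // k.
have step j : resnum (A ^+ j *m L) = 0 ->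
    map_mx polyC (K *m (A ^+ j *m L)) = 0 :> 'M[{poly R}]_(p, q).
  move=> r0; apply: oppr_inj; rewrite oppr0.
  apply: char_poly_dvd_small (size_resnum (A *m (A ^+ j *m L))) _.
  by rewrite resnum_shift r0 scaler0 sub0r scalerN.
have r0 j : resnum (A ^+ j *m L) = 0.
  elim: j => [|j IH]; first by rewrite expr0 mul1mx e1 P0 scaler0.
  by rewrite exprS -mulmxE -mulmxA resnum_shift IH step // !scaler0 subrr.
have /matrixP e0 := step k (r0 k); apply/matrixP=> i j; apply: polyC_inj.
by have := e0 i j; rewrite [X in X = _]mxE => ->; rewrite !mxE.
Qed.

End Numerator.
End Resolvent.
End RationalMatrices.

(** * Values of the transfer function *)

Section Transfer.
Variables (R : realType) (m n : nat).
Variables (G : 'M[{fraction {poly R}}]_m).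
Variables (A : 'M[R]_n) (B : 'M[R]_(n, m)) (C : 'M[R]_(m, n)) (D : 'M[R]_m).
Hypothesis G_real : realization A B C D G.
Local Notation frac := (@FracField.tofrac {poly R}).
Local Notation cpoly := (map_poly (real_complex R)).

Lemma realization_frac i j :
  G i j * frac (char_poly A)
  = frac ((resnum C A B + char_poly A *: map_mx polyC D) i j).
Proof.
have : frac (char_poly A) *: G
     = map_mx frac (resnum C A B + char_poly A *: map_mx polyC D).
  rewrite map_mxD map_mxZ -resnumE -map_cst_rat -scalerDr; congr (_ *: _).
  exact: G_real.
move=> /matrixP/(_ i j); rewrite [X in X = _]mxE [X in _ = X -> _]mxE => <-.
by rewrite mulrC.
Qed.

Section At.
Variable z : R[i].
Hypothesis zA : (cpoly (char_poly A)).[z] != 0.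

Lemma map_char_poly_mx_at :
  map_mx (horner_eval z \o cpoly) (char_poly_mx A) = z%:M - cmx A.
Proof.
apply/matrixP=> i j; rewrite !mxE /= rmorphB /= map_polyC rmorphMn /= map_polyX.
by rewrite /horner_eval hornerD hornerN hornerC hornerMn hornerX.
Qed.

Lemma resolvent_at_unit : z%:M - cmx A \in unitmx.
Proof.
rewrite unitmxE -map_char_poly_mx_at det_map_mx unitfE; exact: zA.
Qed.

Lemma adj_at :
  map_mx (horner_eval z \o cpoly) (\adj (char_poly_mx A))
  = (cpoly (char_poly A)).[z] *: invmx (z%:M - cmx A).
Proof.
rewrite map_mx_adj map_char_poly_mx_at /invmx resolvent_at_unit scalerA.
have -> : (cpoly (char_poly A)).[z] = \det (z%:M - cmx A).
  by rewrite -map_char_poly_mx_at det_map_mx.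
by rewrite mulfV ?scale1r // -unitfE -unitmxE resolvent_at_unit.
Qed.

(** The values of G are defined entrywise through reduced fractions; away from
    the spectrum of A they agree with the state-space formula because both are
    the quotient of one numerator by the characteristic polynomial. *)
Lemma mxreval_realization :
  mxreval G z = cmx C *m invmx (z%:M - cmx A) *m cmx B + cmx D.
Proof.
apply/matrixP=> i j; rewrite [LHS]mxE.
rewrite (reval_frac (realization_frac i j) zA).
set N := _ + _.
have -> : (cpoly (N i j)).[z] = map_mx (horner_eval z \o cpoly) N i j.
  by rewrite [RHS]mxE.
have mC r s (M : 'M[R]_(r, s)) :
    map_mx (horner_eval z \o cpoly) (map_mx polyC M) = cmx M.
  by apply/matrixP=> k l; rewrite !mxE /= map_polyC /= /horner_eval hornerC.
rewrite map_mxD map_mxZ !map_mxM /= !mC adj_at -scalemxAr -scalemxAl -scalerDr.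
by rewrite [X in X / _]mxE mulrC mulKf.
Qed.

End At.
End Transfer.

(** * Reachability, observability and minimality *)

Section State.
Variables (R : comRingType) (m n : nat) (A : 'M[R]_n) (B : 'M[R]_(n, m)).

(** Inputs are listed most recent first: the dynamics are then the recursion
    on lists, and zeros appended at the end only move the starting time. *)
Fixpoint state (l : seq 'cV[R]_m) : 'cV[R]_n :=
  if l is w :: l' then A *m state l' + B *m w else 0.

Definition reachable := forall x, exists l, state l = x.

Lemma state_cat0 l k : state (l ++ nseq k 0) = state l.
Proof.
elim: l => [|w l IH] /=; last by rewrite IH.
by elim: k => [//|k IH] /=; rewrite IH !mulmx0 addr0.
Qed.

Lemma state_map (T : Type) (s : seq T) (c d : R) (f g : T -> 'cV[R]_m) :
  state [seq c *: f t + d *: g t | t <- s]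
  = c *: state (map f s) + d *: state (map g s).
Proof.
elim: s => [|t s IH] /=; first by rewrite !scaler0 addr0.
by rewrite IH !mulmxDr !scalerDr -!scalemxAr addrACA.
Qed.

Lemma reachable_eq0 p (K : 'M[R]_(p, n)) :
  reachable -> (forall k, K *m (A ^+ k *m B) = 0) -> K = 0.
Proof.
move=> reach e.
have e1 l : forall k, K *m (A ^+ k *m state l) = 0.
  elim: l => [|w l IH] k /=; first by rewrite !mulmx0.
  rewrite !mulmxDr !mulmxA -(mulmxA _ _ B) e mul0mx addr0.
  by rewrite -(mulmxA K) mulmxE -exprSr -mulmxA IH.
apply/matrixP=> i j; have [l el] := reach (delta_mx j 0).
have := e1 l 0; rewrite el expr0 mul1mx => /matrixP/(_ i 0).
rewrite [X in _ = X -> _]mxE => e0.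
rewrite [RHS]mxE -[RHS]e0 mxE (bigD1 j) //= mxE !eqxx mulr1.
by rewrite big1 ?addr0 // => k kj; rewrite mxE (negPf kj) mulr0.
Qed.

End State.

(** Defined by duality, so that results on reachability transfer by transposition. *)
Definition observable (R : comRingType) (m n : nat)
    (A : 'M[R]_n) (C : 'M[R]_(m, n)) := reachable A^T C^T.

Lemma trmx_exp (R : comRingType) n (A : 'M[R]_n) k : (A ^+ k)^T = A^T ^+ k.
Proof.
elim: k => [|k IH]; first by rewrite !expr0 trmx1.
by rewrite exprS -mulmxE trmx_mul IH mulmxE -exprSr.
Qed.

Lemma observable_eq0 (R : comRingType) (m n p : nat)
    (A : 'M[R]_n) (C : 'M[R]_(m, n)) (L : 'M[R]_(n, p)) :
  observable A C -> (forall k, C *m (A ^+ k *m L) = 0) -> L = 0.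
Proof.
move=> obs e; apply: trmx_inj; rewrite trmx0.
apply: (reachable_eq0 obs) => k.
by rewrite -trmx_exp -!trmx_mul -mulmxA e trmx0.
Qed.

(** A matrix of maximal rank among those whose row space lies in P exhausts P. *)
Lemma linear_set_rowspace (F : fieldType) n (P : 'rV[F]_n -> Prop) :
  P 0 -> (forall a u v, P u -> P v -> P (a *: u + v)) ->
  exists S : 'M[F]_n, forall v, P v <-> (v <= S)%MS.
Proof.
move=> P0 PD.
pose Q k := `[< exists2 S : 'M[F]_n, \rank S = k & forall v, (v <= S)%MS -> P v >].
have Qex : exists k, Q k.
  exists 0%N; apply/asboolP; exists 0; first exact: mxrank0.
  by move=> v; rewrite submx0 => /eqP ->.
have Qn k : Q k -> (k <= n)%N by move=> /asboolP [S <- _]; exact: rank_leq_row.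
have [k /asboolP[S rS PS] kmax] := ex_maxnP Qex Qn.
exists S => v; split=> [Pv|]; last exact: PS.
suff : (S + v <= S)%MS by rewrite addsmx_sub => /andP[].
rewrite -(geq_leqif (mxrank_leqif_sup (addsmxSl S v))) rS; apply: kmax.
apply/asboolP; exists (S + v)%MS => // u /sub_addsmxP[[u1 u2] ->] /=.
rewrite addrC [u2]mx11_scalar mul_scalar_mx; apply: PD => //.
by apply: PS; exact: submxMl.
Qed.

Section Minimality.
Variables (R : realType) (m : nat) (G : 'M[{fraction {poly R}}]_m).
Local Notation frac := (@FracField.tofrac {poly R}).

(** The change of variables x = Phi x' intertwines the two resolvents. *)
Lemma realization_reduce n r (A : 'M[R]_n) (B : 'M[R]_(n, m))
    (C : 'M[R]_(m, n)) (D : 'M[R]_m)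
    (A' : 'M[R]_r) (B' : 'M[R]_(r, m)) (Phi : 'M[R]_(n, r)) :
  realization A B C D G -> A *m Phi = Phi *m A' -> B = Phi *m B' ->
  realization A' B' (C *m Phi) D G.
Proof.
move=> real AP BP; rewrite /realization real BP !map_cst_rat !map_mxM -!map_cst_rat.
congr (_ + _); rewrite !mulmxA; congr (_ *m _).
rewrite -!(mulmxA (map_mx _ C)); congr (_ *m _).
have e : pencil A *m map_mx (@cst_rat R) Phi
       = map_mx (@cst_rat R) Phi *m pencil A'.
  rewrite /pencil mulmxBl mulmxBr mul_scalar_mx mul_mx_scalar; congr (_ - _).
  by rewrite !map_cst_rat -!map_mxM AP.
rewrite -/(pencil A) -/(pencil A').
rewrite -[RHS](mulKmx (pencil_unit A)); congr (_ *m _).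
by rewrite mulmxA e -mulmxA mulmxV ?pencil_unit // mulmx1.
Qed.

(** Restricting the realization to its reachable subspace leaves the transfer
    function unchanged, so minimality forces that subspace to be everything. *)
Lemma minimal_reachable n (A : 'M[R]_n) (B : 'M[R]_(n, m))
    (C : 'M[R]_(m, n)) (D : 'M[R]_m) :
  minimal_realization A B C D G -> reachable A B.
Proof.
move=> [real nmin].
have [||S SP] := @linear_set_rowspace R n (fun v => exists l, state A B l = v^T).
- by exists [::]; rewrite trmx0.
- move=> a u v [l1 e1] [l2 e2].
  (* Padding with zeros in the past gives both inputs the same length. *)
  pose s := zip (l1 ++ nseq (size l2) 0) (l2 ++ nseq (size l1) 0).
  have sz : size (l1 ++ nseq (size l2) 0) = size (l2 ++ nseq (size l1) 0).
    by rewrite !size_cat !size_nseq addnC.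
  exists [seq a *: t.1 + 1 *: t.2 | t <- s].
  rewrite state_map -/(unzip1 s) -/(unzip2 s) unzip1_zip ?sz // unzip2_zip ?sz //.
  by rewrite !state_cat0 e1 e2 scale1r linearD linearZ.
have SB : (B^T <= S)%MS.
  apply/row_subP => i; apply/SP; exists [:: delta_mx i 0].
  by rewrite /= mulmx0 add0r -colE tr_row trmxK.
have SA : (S *m A^T <= S)%MS.
  apply/row_subP => i; apply/SP; have [l e] := (SP (row i S)).2 (row_sub i S).
  exists (0 :: l); rewrite /= mulmx0 addr0 e row_mul trmx_mul trmxK //.
have rfull : row_full S.
  pose Phi := (row_base S)^T.
  have [A' eA] : exists A', row_base S *m A^T = A' *m row_base S.
    by apply/submxP; rewrite eq_row_base (submx_trans _ SA) // submxMr // eq_row_base.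
  have [B' eB] : exists B', B^T = B' *m row_base S.
    by apply/submxP; rewrite eq_row_base.
  rewrite /row_full eqn_leq rank_leq_col; apply: (nmin _ A'^T B'^T (C *m Phi) D).
  apply: (realization_reduce real); apply: trmx_inj.
    by rewrite !trmx_mul !trmxK.
  by rewrite trmx_mul !trmxK.
move=> x; have [l e] := (SP x^T).2 (submx_full _ rfull).
by exists l; rewrite e trmxK.
Qed.

Section Symmetric.
Hypothesis G_sym : G^T = G.
Variables (n : nat) (A : 'M[R]_n) (B : 'M[R]_(n, m)) (C : 'M[R]_(m, n)).
Variable D : 'M[R]_m.

Lemma realization_tr n' (A' : 'M[R]_n') B' C' D' :
  realization A' B' C' D' G -> realization A'^T C'^T B'^T D'^T G.
Proof.
move=> real; rewrite /realization -{1}G_sym {1}real linearD /= !trmx_mul mulmxA.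
by rewrite !map_trmx trmx_inv linearB /= tr_scalar_mx map_trmx.
Qed.

Lemma minimal_observable : minimal_realization A B C D G -> observable A C.
Proof.
move=> [real nmin]; apply: (@minimal_reachable _ _ _ B^T D^T); split.
  exact: realization_tr.
by move=> n' A' B' C' D' /realization_tr; exact: nmin.
Qed.

Hypothesis G_real : realization A B C D G.

(** G - G^T has numerator of degree less than n plus the characteristic
    polynomial times D - D^T. Its vanishing kills both parts, and then all the
    Markov parameters of G - G^T. *)
Lemma symmetric_markov :
  D = D^T /\ forall k, (C *m (A ^+ k *m B))^T = C *m (A ^+ k *m B).
Proof.
pose N k := resnum C A (A ^+ k *m B).
have sN k (i j : 'I_m) : (size (((N k - (N k)^T) : 'M_m) i j)%R <= n)%N.
  rewrite mxE [X in _ + X]mxE [X in _ - X]mxE (leq_trans (size_polyD _ _)) //.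
  by rewrite size_polyN geq_max !size_resnum.
have e0 : N 0 - (N 0)^T = char_poly A *: map_mx polyC (D^T - D).
  rewrite /N expr0 mul1mx; apply/matrixP=> i j.
  have /eqP : frac ((resnum C A B + char_poly A *: map_mx polyC D) i j)
       = frac ((resnum C A B + char_poly A *: map_mx polyC D) j i).
    by rewrite -!(realization_frac G_real) -{1}G_sym mxE.
  rewrite tofrac_eq => /eqP; rewrite !mxE polyCD polyCN.
  move: (\sum_(_ < _) _) (\sum_(_ < _) _) => a b e.
  by rewrite mulrDr mulrN; apply/eqP; rewrite subr_eq addrAC -subr_eq opprK e addrC.
have D0 := char_poly_dvd_small (sN 0) e0.
have eN k : N k.+1 - (N k.+1)^T = 'X *: (N k - (N k)^T)
    + char_poly A *: map_mx polyC ((C *m (A ^+ k *m B))^T - C *m (A ^+ k *m B)).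
  rewrite /N exprS -mulmxE -mulmxA resnum_shift; move: (resnum _ _ _) => M.
  rewrite map_mxB -map_trmx; apply/matrixP=> i j; rewrite !mxE; ring.
have N0 k : N k - (N k)^T = 0.
  elim: k => [|k IH]; first by rewrite e0 D0 scaler0.
  have e := eN k; rewrite IH scaler0 add0r in e.
  have P0 := char_poly_dvd_small (sN k.+1) e.
  by rewrite e P0 scaler0.
have cst0 (M : 'M[R]_m) : map_mx polyC M = 0 -> M = 0.
  move=> /matrixP M0; apply/matrixP=> i j; apply: polyC_inj.
  by have := M0 i j; rewrite [X in X = _]mxE => ->; rewrite !mxE.
split=> [|k].
  by apply/esym/eqP; rewrite -subr_eq0; apply/eqP/cst0.
have e := eN k; rewrite (N0 k) scaler0 add0r in e.
by apply/eqP; rewrite -subr_eq0; apply/eqP/cst0; apply: char_poly_dvd_small (sN k.+1) e.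
Qed.

Hypothesis (reach : reachable A B) (obs : observable A C).

(** Let d clear all denominators of G. Then C d(A) (zI - A)^-1 B is a
    polynomial, so C A^j d(A) A^k B = 0 for all j and k, and minimality gives
    d(A) = 0. Hence every eigenvalue of A is a root of d. *)
Lemma eigenvalue_pole z :
  root (map_poly (real_complex R) (char_poly A)) z ->
  exists i j, pole (G i j) z.
Proof.
move: n A B C G_real reach obs => [|n'] A0 B0 C0 real0 reach0 obs0.
  by rewrite /char_poly det_mx00 rmorph1 (negPf (root1 z)).
move=> rz; pose d := \prod_i \prod_j rden (G i j).
have dG i j : G i j * frac d = frac (rnum (G i j) * (d %/ rden (G i j))).
  have /divpK {1}<- : rden (G i j) %| d.
    by rewrite /d (bigD1 i) //= (bigD1 j) //= -mulrA dvdp_mulr.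
  by rewrite !rmorphM /= mulrCA rnumden mulrC.
pose a : 'M[{poly R}]_m := \matrix_(i, j) (rnum (G i j) * (d %/ rden (G i j))).
have dGa : frac d *: G = map_mx frac a.
  by apply/matrixP=> i j; rewrite [LHS]mxE mulrC dG [RHS]mxE [in RHS]mxE.
(* Multiplying the resolvent by p is substituting A for z, up to a polynomial. *)
have key p : exists P, frac p *: (map_mx (@cst_rat R) C0 *m invmx (pencil A0)
        *m map_mx (@cst_rat R) B0) =
     map_mx (@cst_rat R) (C0 *m horner_mx A0 p) *m invmx (pencil A0)
        *m map_mx (@cst_rat R) B0 + map_mx frac P.
  elim/poly_ind: p => [|p c [P IH]].
    exists 0; rewrite !rmorph0 scale0r mulmx0 map_cst_rat.
    by rewrite !map_mx0 !mul0mx addr0.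
  pose KB := C0 *m horner_mx A0 p *m B0.
  exists ('X *: P + map_mx polyC KB).
  have shift : frac 'X *: (map_mx (@cst_rat R) (C0 *m horner_mx A0 p)
        *m invmx (pencil A0) *m map_mx (@cst_rat R) B0)
     = map_mx (@cst_rat R) (C0 *m horner_mx A0 p *m A0) *m invmx (pencil A0)
        *m map_mx (@cst_rat R) B0 + map_mx (@cst_rat R) KB.
    have -> : map_mx (@cst_rat R) (C0 *m horner_mx A0 p *m A0)
        = map_mx (@cst_rat R) (C0 *m horner_mx A0 p) *m map_mx (@cst_rat R) A0.
      by rewrite !map_cst_rat -map_mxM -map_mxM.
    have -> : map_mx (@cst_rat R) KB
        = map_mx (@cst_rat R) (C0 *m horner_mx A0 p) *m map_mx (@cst_rat R) B0.
      by rewrite !map_cst_rat -map_mxM -map_mxM.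
    have -> : map_mx (@cst_rat R) A0 = (frac 'X)%:M - pencil A0.
      by rewrite /pencil opprB addrC subrK.
    rewrite mulmxBr mul_mx_scalar mulmxBl mulmxK ?pencil_unit // mulmxBl subrK.
    by rewrite -!scalemxAl.
  have -> : C0 *m horner_mx A0 (p * 'X + c%:P)
     = C0 *m horner_mx A0 p *m A0 + c *: C0.
    rewrite rmorphD rmorphM /= horner_mx_X horner_mx_C mulmxDr.
    by rewrite -mulmxE mulmxA mul_mx_scalar.
  have -> : map_mx (@cst_rat R) (C0 *m horner_mx A0 p *m A0 + c *: C0) =
     map_mx (@cst_rat R) (C0 *m horner_mx A0 p *m A0)
     + frac c%:P *: map_mx (@cst_rat R) C0.
    by rewrite !map_cst_rat map_mxD map_mxZ map_mxD map_mxZ.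
  rewrite rmorphD rmorphM /= scalerDl mulrC -scalerA IH scalerDr shift.
  rewrite [map_mx frac (_ + _)]map_mxD map_mxZ -map_cst_rat mulmxDl mulmxDl.
  rewrite -!scalemxAl -!addrA; congr (_ + _).
  by rewrite addrC -addrA addrCA.
have [P eP] := key d.
have rP : map_mx (@cst_rat R) (C0 *m horner_mx A0 d) *m invmx (pencil A0)
        *m map_mx (@cst_rat R) B0 = map_mx frac (a - d *: map_mx polyC D - P).
  rewrite 2!map_mxB map_mxZ -map_cst_rat -dGa {1}real0 scalerDr addrK.
  by rewrite -/(pencil A0) eP addrK.
have [_ CdB] := resolvent_poly rP.
have Aj j : C0 *m horner_mx A0 d *m A0 ^+ j = 0.
  apply: (reachable_eq0 reach0) => k; rewrite -[RHS](CdB (j + k)%N).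
  by rewrite exprD -mulmxE !mulmxA.
have dA : horner_mx A0 d = 0.
  apply: (observable_eq0 obs0) => k; rewrite -[RHS](Aj k) -mulmxA; congr (_ *m _).
  by rewrite -{1 4}(horner_mx_X A0) -rmorphXn /= !mulmxE -!rmorphM mulrC.
have : root (map_poly (real_complex R) d) z.
  have : mxminpoly (cmx A0) %| map_poly (real_complex R) d.
    by apply: mxminpoly_min; rewrite -map_horner_mx dA map_mx0.
  move=> /dvdpP[q ->].
  by rewrite rootM root_mxminpoly -map_char_poly [root (map_poly _ _) z]rz orbT.
rewrite /d rmorph_prod /root horner_prod prodf_seq_eq0 => /hasP[i _ /=].
rewrite rmorph_prod horner_prod prodf_seq_eq0 => /hasP[j _ /= ?].
by exists i, j.
Qed.
End Symmetric.
End Minimality.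

(** * Contractions and indefinite Hermitian forms *)

Section Hermitian.
Local Open Scope sesquilinear_scope.
Variable C : numClosedFieldType.
Implicit Types n : nat.

Lemma trmxC_mul p q r (M : 'M[C]_(p, q)) (N : 'M[C]_(q, r)) :
  (M *m N) ^t* = N ^t* *m M ^t*.
Proof. by rewrite trmx_mul map_mxM. Qed.

Lemma trmxC_inv n (M : 'M[C]_n) : (invmx M) ^t* = invmx (M ^t*).
Proof. by rewrite trmx_inv map_invmx. Qed.

Lemma trmxC_unit n (M : 'M[C]_n) : (M ^t* \in unitmx) = (M \in unitmx).
Proof. by rewrite map_unitmx unitmx_tr. Qed.

Lemma hermsymmxP n (M : 'M[C]_n) : (M \is hermsymmx) = (M ^t* == M).
Proof. by rewrite qualifE /= expr0 scale1r eq_sym. Qed.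

Definition sqnorm n (v : 'cV[C]_n) : C := (v ^t* *m v) 0 0.

Lemma sqnormE n (v : 'cV[C]_n) : sqnorm v = \sum_i `|v i 0| ^+ 2.
Proof.
by rewrite /sqnorm mxE; apply: eq_bigr => i _; rewrite !mxE mulrC -normCK.
Qed.

Lemma sqnorm_gt0 n (v : 'cV[C]_n) : v != 0 -> 0 < sqnorm v.
Proof.
move=> v0; rewrite sqnormE lt_def sumr_ge0 ?andbT => [|i _]; last exact: exprn_ge0.
apply: contraNneq v0 => /eqP; rewrite psumr_eq0 => [/allP e|i _]; last exact: exprn_ge0.
apply/eqP/matrixP=> i j; rewrite [j]ord1 [RHS]mxE; apply/eqP.
by have := e i (mem_index_enum i); rewrite expf_eq0 /= normr_eq0.
Qed.

Lemma sqnorm_mul p n (M : 'M[C]_(p, n)) (v : 'cV[C]_n) :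
  sqnorm (M *m v) = (v ^t* *m (M ^t* *m M) *m v) 0 0.
Proof. by rewrite /sqnorm trmxC_mul !mulmxA. Qed.

Lemma sqnormZ n a (v : 'cV[C]_n) : sqnorm (a *: v) = `|a| ^+ 2 * sqnorm v.
Proof.
by rewrite !sqnormE mulr_sumr; apply: eq_bigr => i _; rewrite mxE normrM exprMn.
Qed.

Lemma sqnorm_diag n (d : 'rV[C]_n) (v : 'cV[C]_n) :
  sqnorm (diag_mx d *m v) = \sum_i `|d 0 i| ^+ 2 * `|v i 0| ^+ 2.
Proof.
by rewrite sqnormE; apply: eq_bigr => i _; rewrite mul_diag_mx mxE normrM exprMn.
Qed.

Lemma form_diag n (d : 'rV[C]_n) (v : 'cV[C]_n) :
  (v ^t* *m diag_mx d *m v) 0 0 = \sum_i d 0 i * `|v i 0| ^+ 2.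
Proof.
rewrite -mulmxA mxE; apply: eq_bigr => i _.
by rewrite mul_diag_mx !mxE mulrCA mulrA -mulrA normCK [_ * _^*]mulrC.
Qed.

Lemma hermitian_spectral n (M : 'M[C]_n) : M \is hermsymmx ->
  exists U : 'M[C]_n, exists d : 'rV[C]_n,
   [/\ U *m U ^t* = 1%:M, U ^t* *m U = 1%:M, M = U ^t* *m diag_mx d *m U
     & forall i, d 0 i \is Num.real].
Proof.
move=> Mh; have /orthomx_spectralP e := hermitian_normalmx Mh.
have Pu := spectral_unitarymx M; have UU := unitarymxP Pu.
exists (spectralmx M), (spectral_diag M); split=> //.
- exact: mulmx1C.
- by rewrite -invmx_unitary.
- by move=> i; have /mxOverP := hermitian_spectral_diag_real Mh; apply.
Qed.

(** Spectral decomposition, with the square roots of the eigenvalues. *)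
Lemma pd_factor n (X : 'M[C]_n) : X \is hermsymmx ->
  (forall v : 'cV[C]_n, v != 0 -> 0 < (v ^t* *m X *m v) 0 0) ->
  exists2 Y : 'M[C]_n, Y \in unitmx & X = Y ^t* *m Y.
Proof.
move=> Xh Xpd; have [U [d [UU1 UU2 XE dr]]] := hermitian_spectral Xh.
have Uu : U \in unitmx by have [] := mulmx1_unit UU1.
have dpos i : 0 < d 0 i.
  pose e : 'cV[C]_n := delta_mx i 0.
  have := Xpd (U ^t* *m e).
  have -> : (U ^t* *m e) ^t* *m X *m (U ^t* *m e) = e ^t* *m diag_mx d *m e.
    rewrite trmxC_mul trmxCK XE !mulmxA.
    by rewrite -(mulmxA _ U) UU1 mulmx1 -(mulmxA _ U) UU1 mulmx1.
  rewrite form_diag (bigD1 i) //= big1 => [|k /negPf ki]; last first.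
    by rewrite mxE ki normr0 expr0n mulr0.
  rewrite mxE !eqxx normr1 expr1n mulr1 addr0; apply.
  apply: contraTneq isT => /(congr1 (mulmx U)); rewrite mulmxA UU1 mul1mx mulmx0.
  move=> /matrixP/(_ i 0); rewrite !mxE !eqxx => /eqP; by rewrite oner_eq0.
pose s : 'rV[C]_n := \row_i sqrtC (d 0 i).
have s_real : (diag_mx s) ^t* = diag_mx s.
  rewrite tr_diag_mx; apply/matrixP=> i j; rewrite !mxE.
  case: eqP => _; rewrite ?mulr0n ?conjC0 // mulr1n.
  by apply: conj_Creal; rewrite ger0_real // sqrtC_ge0 ltW.
exists (diag_mx s *m U); last first.
  rewrite trmxC_mul s_real mulmxA -(mulmxA _ (diag_mx s) (diag_mx s)) mulmx_diag XE.
  congr (_ *m diag_mx _ *m _); apply/rowP=> i.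
  by rewrite !mxE -expr2 sqrtCK.
rewrite unitmx_mul Uu andbT unitmxE det_diag unitfE prodf_seq_neq0.
apply/allP=> i _ /=; by rewrite mxE sqrtC_eq0 gt_eqF.
Qed.

(** Congruence by a factor of X turns X into the identity; a unitary change of
    basis then diagonalizes M and keeps the identity. *)
Lemma simultaneous_diag n (X M : 'M[C]_n) : X \is hermsymmx ->
  (forall v : 'cV[C]_n, v != 0 -> 0 < (v ^t* *m X *m v) 0 0) ->
  M \is hermsymmx ->
  exists Z : 'M[C]_n, exists d : 'rV[C]_n,
   [/\ Z \in unitmx, X = Z ^t* *m Z, M = Z ^t* *m diag_mx d *m Z
     & forall i, d 0 i \is Num.real].
Proof.
move=> Xh Xpd Mh; have [Y Yu XE] := pd_factor Xh Xpd.
have Nh : (invmx Y) ^t* *m M *m invmx Y \is hermsymmx.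
  move: Mh; rewrite !hermsymmxP => /eqP Mh.
  by rewrite !trmxC_mul trmxCK Mh mulmxA.
have [U [d [UU1 UU2 NE dr]]] := hermitian_spectral Nh.
have Uu : U \in unitmx by have [] := mulmx1_unit UU1.
exists (U *m Y), d; split=> //.
- by rewrite unitmx_mul Uu.
- by rewrite trmxC_mul -mulmxA (mulmxA _ U) UU2 mul1mx.
have -> : M = Y ^t* *m ((invmx Y) ^t* *m M *m invmx Y) *m Y.
  by rewrite trmxC_inv !mulmxA mulmxV ?trmxC_unit // mul1mx mulmxKV.
by rewrite NE trmxC_mul !mulmxA.
Qed.

Section Contraction.
Variables (n : nat) (A : 'M[C]_n) (d : 'rV[C]_n).
Hypothesis d_real : forall i, d 0 i \is Num.real.
Hypothesis d_neq0 : forall i, d 0 i != 0.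
Hypothesis A_contr : forall v, sqnorm (A *m v) <= sqnorm v.
Hypothesis A_sym : diag_mx d *m A = A ^t* *m diag_mx d.

(** If A contracts the Euclidean norm and is self-adjoint for the indefinite
    form d, then it also contracts the definite form |d|. With J the sign of d,
    an eigenvector x of the pencil A^* |d| A - nu |d| satisfies
    A J A x = nu J x, and A and J do not increase the norm, so nu is at most 1. *)
Lemma contraction_abs (v : 'cV[C]_n) :
  \sum_i `|d 0 i| * `|(A *m v) i 0| ^+ 2 <= \sum_i `|d 0 i| * `|v i 0| ^+ 2.
Proof.
pose s : 'rV[C]_n := \row_i sqrtC `|d 0 i|.
pose J : 'M[C]_n := diag_mx (\row_i Num.sg (d 0 i)).
pose S := diag_mx s.
have Sreal : S ^t* = S.
  rewrite tr_diag_mx; apply/matrixP=> i j; rewrite !mxE.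
  case: eqP => _; rewrite ?mulr0n ?conjC0 // mulr1n.
  by apply: conj_Creal; rewrite ger0_real // sqrtC_ge0.
have Su : S \in unitmx.
  rewrite unitmxE det_diag unitfE prodf_seq_neq0.
  by apply/allP=> i _ /=; rewrite mxE sqrtC_eq0 normr_eq0.
have Du : diag_mx d \in unitmx.
  by rewrite unitmxE det_diag unitfE prodf_seq_neq0; apply/allP=> i _ /=.
have SS : S *m S = diag_mx d *m J.
  rewrite !mulmx_diag; congr diag_mx; apply/rowP=> i.
  rewrite !mxE -expr2 sqrtCK.
  have [dp|dn|->] := real_ltgt0P (d_real i); last by rewrite mul0r.
    by rewrite gtr0_sg // mulr1.
  by rewrite ltr0_sg // mulrN1.
have sqS u : sqnorm (S *m u) = \sum_i `|d 0 i| * `|u i 0| ^+ 2.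
  rewrite sqnorm_diag; apply: eq_bigr => i _; rewrite mxE; congr (_ * _).
  by rewrite ger0_norm ?sqrtC_ge0 // sqrtCK.
have sqJ u : sqnorm (J *m u) = sqnorm u.
  rewrite sqnorm_diag sqnormE; apply: eq_bigr => i _.
  by rewrite mxE normr_sg d_neq0 expr1n mul1r.
(* The claim says that W, the matrix of A in the norm |d|, is a contraction. *)
pose W := S *m A *m invmx S.
have Nh : W ^t* *m W \is hermsymmx.
  by rewrite hermsymmxP trmxC_mul trmxCK.
have [U [nu [UU1 UU2 NE nur]]] := hermitian_spectral Nh.
have nu1 i : nu 0 i <= 1.
  pose y := U ^t* *m (delta_mx i 0 : 'cV_n); pose x := invmx S *m y.
  have y0 : y != 0.
    apply: contraTneq isT => /(congr1 (mulmx U)); rewrite mulmxA UU1 mul1mx mulmx0.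
    by move=> /matrixP/(_ i 0); rewrite !mxE !eqxx => /eqP; rewrite oner_eq0.
  have x0 : x != 0.
    by apply: contraNneq y0 => x0; rewrite -[y](mulKVmx Su) -/x x0 mulmx0.
  have Ny : W ^t* *m W *m y = nu 0 i *: y.
    rewrite NE /y !mulmxA -!(mulmxA _ U) UU1 mulmx1 -mulmxA scalemxAr; congr (_ *m _).
    apply/matrixP=> k l; rewrite mul_diag_mx !mxE.
    by case: eqP => [->|_]; rewrite ?mulr0.
  have Wy : W *m y = S *m (A *m x) by rewrite /W -!mulmxA.
  have yE : y = S *m x by rewrite mulKVmx.
  clearbody x y; move: Ny; rewrite -mulmxA Wy yE /W !trmxC_mul trmxC_inv Sreal.
  move=> /(congr1 (mulmx S)); rewrite -scalemxAr !mulmxA mulmxV // mul1mx.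
  rewrite -(mulmxA _ S S) SS mulmxA -A_sym -!mulmxA scalemxAr.
  move=> /(can_inj (mulKmx Du)) e.
  have : `|nu 0 i| ^+ 2 * sqnorm x <= 1 * sqnorm x.
    rewrite mul1r -[sqnorm x in leLHS]sqJ -sqnormZ -e (le_trans (A_contr _)) //.
    by rewrite sqJ A_contr.
  rewrite ler_pM2r ?sqnorm_gt0 // expr_le1 // => nle.
  by rewrite (le_trans (real_ler_norm (nur i))).
rewrite -!sqS; have -> : S *m (A *m v) = W *m (S *m v).
  by rewrite /W -!mulmxA mulKmx.
move: (S *m v) => w; rewrite sqnorm_mul NE.
have -> : sqnorm w = sqnorm (U *m w) by rewrite sqnorm_mul UU2 mulmx1.
have -> : w ^t* *m (U ^t* *m diag_mx nu *m U) *m w =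
   (U *m w) ^t* *m diag_mx nu *m (U *m w) by rewrite trmxC_mul !mulmxA.
rewrite form_diag sqnormE; apply: ler_sum => i _.
by rewrite ler_piMl // exprn_ge0.
Qed.

(** With - |d| in place of d the sum is nonnegative by [contraction_abs]. On a
    positive coordinate the hypothesis forces (A p)_i = z p_i, so restoring d
    there adds 2 d_i (|z|^2 - 1) |p_i|^2. *)
Lemma indefinite_diag_ge0 z (p : 'cV[C]_n) :
  1 < `|z| -> diag_mx d *m (z *: p - A *m p) = - (z *: p - A *m p) ->
  0 <= \sum_i d 0 i * `|(A *m p) i 0| ^+ 2 - \sum_i d 0 i * `|p i 0| ^+ 2.
Proof.
move=> z1 f.
have /le_trans : 0 <= \sum_i `|d 0 i| * `|p i 0| ^+ 2 - \sum_i `|d 0 i| * `|(A *m p) i 0| ^+ 2.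
  by rewrite subr_ge0 contraction_abs.
apply; rewrite -!sumrB; apply: ler_sum => i _.
have [dp|dn|d0] := real_ltgt0P (d_real i); last by have := d_neq0 i; rewrite d0 eqxx.
  have fi : (A *m p) i 0 = z * p i 0.
    have := congr1 (fun M : 'cV_n => M i 0) f.
    rewrite mul_diag_mx !mxE; set a := z * _; set b := \sum_(_ < _) _ => e.
    apply/eqP; rewrite eq_sym -subr_eq0; apply/eqP.
    have /eqP : (d 0 i + 1) * (a - b) = 0 by rewrite mulrDl e mul1r addNr.
    by rewrite mulf_eq0 gt_eqF ?addr_gt0 //= => /eqP.
  rewrite -!mulrBr; apply: ler_wpM2l; first exact: ltW.
  rewrite fi normrM exprMn (@le_trans _ _ 0) //.
    rewrite subr_le0 ler_peMl ?exprn_ge0 // expr_ge1 // ltW //.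
  by rewrite subr_ge0 ler_peMl ?exprn_ge0 // exprn_ege1 // ltW.
by rewrite !mulNr opprK addrC.
Qed.

End Contraction.

(** The matrix X makes A a contraction, M makes it self-adjoint, and the input
    direction lies in the eigenspace of X^-1 M for -1. This pointwise estimate
    replaces the maximum principle in the upper half of the exterior of the disc. *)
Lemma indefinite_form_ge0 n (X M A : 'M[C]_n) z (p : 'cV[C]_n) :
  X \is hermsymmx ->
  (forall v : 'cV[C]_n, v != 0 -> 0 < (v ^t* *m X *m v) 0 0) ->
  (forall v : 'cV[C]_n, 0 <= (v ^t* *m (X - A ^t* *m X *m A) *m v) 0 0) ->
  M \is hermsymmx -> M \in unitmx -> M *m A = A ^t* *m M ->
  1 < `|z| -> M *m (z *: p - A *m p) = - (X *m (z *: p - A *m p)) ->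
  0 <= (p ^t* *m (A ^t* *m M *m A - M) *m p) 0 0.
Proof.
move=> Xh Xpd XA Mh Mu MA z1 f.
have [Z [d [Zu XE ME dr]]] := simultaneous_diag Xh Xpd Mh.
pose A1 := Z *m A *m invmx Z; pose p1 := Z *m p.
have A1p v : A1 *m (Z *m v) = Z *m (A *m v) by rewrite /A1 -!mulmxA mulKmx.
have d0 i : d 0 i != 0.
  move: Mu; rewrite ME !unitmx_mul => /andP[/andP[_]].
  rewrite unitmxE det_diag unitfE prodf_seq_neq0 => /allP/(_ i) + _.
  by apply; rewrite mem_index_enum.
have contr v : sqnorm (A1 *m v) <= sqnorm v.
  rewrite -[v](mulKVmx Zu) A1p; have := XA (invmx Z *m v).
  set w := invmx Z *m v; rewrite mulmxBr mulmxBl mxE [X in _ + X]mxE subr_ge0.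
  by rewrite XE /sqnorm !trmxC_mul !mulmxA.
have sym : diag_mx d *m A1 = A1 ^t* *m diag_mx d.
  have := congr1 (fun N => (invmx Z) ^t* *m N *m invmx Z) MA.
  rewrite /= ME /A1 !trmxC_mul !trmxC_inv !mulmxA mulVmx ?trmxC_unit // mul1mx.
  by move=> ->; rewrite mulmxK.
have f1 : diag_mx d *m (z *: p1 - A1 *m p1) = - (z *: p1 - A1 *m p1).
  have := congr1 (fun u : 'cV_n => (invmx Z) ^t* *m u) f.
  rewrite /= /p1 A1p scalemxAr -mulmxBr ME XE trmxC_inv mulmxN !mulmxA.
  by rewrite mulVmx ?trmxC_unit // !mul1mx.
have := indefinite_diag_ge0 dr d0 contr sym z1 f1.
rewrite -!form_diag A1p ME => h; rewrite mulmxBr mulmxBl mxE [X in _ + X]mxE.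
by move: h; rewrite /p1 !trmxC_mul !mulmxA.
Qed.
End Hermitian.

(** * The symmetrizer of a symmetric realization *)

Lemma eq_col (T : Type) p q (M N : 'M[T]_(p, q)) :
  (forall j, col j M = col j N) -> M = N.
Proof.
move=> e; apply/matrixP=> i j.
by have /matrixP/(_ i 0) := e j; rewrite !mxE.
Qed.

Section Symmetrizer.
Variables (F : fieldType) (m n : nat).
Variables (A : 'M[F]_n) (B : 'M[F]_(n, m)) (C : 'M[F]_(m, n)).
Hypothesis reach : reachable A B.
Hypothesis obs : observable A C.
Hypothesis markov_sym :
  forall k, (C *m (A ^+ k *m B))^T = C *m (A ^+ k *m B).
Local Notation costate := (state A^T C^T).

(** A state and the costate produced by the same inputs have the same
    continuations, because the Markov parameters are symmetric. *)
Lemma costate_markov l k :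
  B^T *m (A^T ^+ k *m costate l) = C *m (A ^+ k *m state A B l).
Proof.
elim: l k => [|w l IH] k /=; first by rewrite !mulmx0.
rewrite !mulmxDr; congr (_ + _).
  by rewrite !(mulmxA (_ ^+ k)) !mulmxE -!exprSr IH.
by rewrite !mulmxA; congr (_ *m w); rewrite -trmx_exp -!trmx_mul markov_sym mulmxA.
Qed.

Lemma state_costate l l' :
  (state A B l')^T *m costate l = (costate l')^T *m state A B l.
Proof.
elim: l' l => [|w l' IH] l /=; first by rewrite !trmx0 !mul0mx.
rewrite !linearD /= !mulmxDl !trmx_mul !trmxK; congr (_ + _).
  by have := IH (0 :: l); rewrite /= !mulmx0 !addr0 !mulmxA.
rewrite -!mulmxA; congr (_ *m _).
by have := costate_markov l 0; rewrite !expr0 !mul1mx.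
Qed.

(** The state-space isomorphism between the realization and its transpose,
    both being minimal realizations of the same symmetric function: it maps
    the state reached by a list of inputs to the costate reached by that list. *)
Lemma symmetrizer_exists : exists T : 'M[F]_n,
  [/\ T \in unitmx, T^T = T, T *m A = A^T *m T & T *m B = C^T].
Proof.
have [l lE] := choice (fun i : 'I_n => reach (delta_mx i 0)).
pose T : 'M[F]_n := \matrix_(i, j) costate (l j) i 0.
have colT j : col j T = costate (l j).
  by apply/matrixP=> i k; rewrite !mxE [k]ord1.
have BT k : B^T *m (A^T ^+ k *m T) = C *m A ^+ k.
  apply: eq_col => j.
  by rewrite !colE -!mulmxA -(colE j T) colT costate_markov lE.
have Tstate s : T *m state A B s = costate s.
  apply/eqP; rewrite -subr_eq0 -trmx_eq0; apply/eqP.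
  apply: (reachable_eq0 reach) => k; apply: trmx_inj.
  rewrite trmx0 !trmx_mul trmxK trmx_exp -mulmxA !mulmxBr costate_markov.
  by rewrite !mulmxA -(mulmxA B^T) BT subrr.
have TB : T *m B = C^T.
  apply: eq_col => j; rewrite !colE -mulmxA.
  by have := Tstate [:: delta_mx j 0]; rewrite /= !mulmx0 !add0r.
have TA : T *m A = A^T *m T.
  apply: eq_col => j; rewrite !colE -!mulmxA -lE Tstate.
  by have := Tstate (0 :: l j); rewrite /= !mulmx0 !addr0.
have Tsym : T^T = T.
  apply/matrixP=> i j; rewrite mxE.
  have := state_costate (l j) (l i); rewrite -!Tstate !lE => /matrixP/(_ 0 0).
  by rewrite trmx_delta -rowE -!colE !mxE => ->.
exists T; split=> //; rewrite -row_free_unit -kermx_eq0 -trmx_eq0; apply/eqP.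
apply: (observable_eq0 obs) => k; rewrite mulmxA -BT -!mulmxA.
by rewrite -{1}Tsym -trmx_mul mulmx_ker trmx0 !mulmx0.
Qed.
End Symmetrizer.

(** * Sufficiency of the Stein inequality *)

Lemma derivable_poly (K : numFieldType) (p : {poly K}) (x : K) :
  derivable (horner p : K^o -> K^o) x 1.
Proof.
elim/poly_ind: p => [|p c IH].
  have -> : horner (0 : {poly K}) = cst 0 by apply/funext => y; rewrite horner0.
  exact: derivable_cst.
have -> : horner (p * 'X + c%:P) = (horner p : K^o -> K^o) * id + cst c.
  by apply/funext => y; rewrite !hornerE.
apply: derivableD; last exact: derivable_cst.
by apply: derivableM; [exact: IH | exact: derivable_id].
Qed.

Section Sufficiency.
Local Open Scope sesquilinear_scope.

Lemma trmxC11 (K : numClosedFieldType) (M : 'M[K]_1) : (M ^t*) 0 0 = (M 0 0)^*.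
Proof. by rewrite !mxE. Qed.

Lemma mx11B (K : pzRingType) (M N : 'M[K]_1) : (M - N) 0 0 = M 0 0 - N 0 0.
Proof. by rewrite !mxE. Qed.

Lemma mx11D (K : pzRingType) (M N : 'M[K]_1) : (M + N) 0 0 = M 0 0 + N 0 0.
Proof. by rewrite !mxE. Qed.

Lemma mx11Z (K : pzRingType) a (M : 'M[K]_1) : (a *: M) 0 0 = a * M 0 0.
Proof. by rewrite !mxE. Qed.

(** All the numbers p^* M A^k p are real, because M A^k is Hermitian. Hence
    only the conjugate of z contributes to the imaginary part. *)
Lemma NI_form_identity (K : numClosedFieldType) n (A M : 'M[K]_n) z (p : 'cV[K]_n) :
  M \is hermsymmx -> M *m A = A ^t* *m M ->
  let g := ((z *: p - A *m p) ^t* *m (M *m (A *m A - 1%:M)) *m p) 0 0 in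
  'i * (g - g^*) =
  2 * 'Im z * (p ^t* *m (A ^t* *m M *m A - M) *m p) 0 0.
Proof.
move=> /[!hermsymmxP] /eqP Mh MA /=.
pose N k := M *m A ^+ k; pose kap k := (p ^t* *m N k *m p) 0 0.
have Nh k : (N k) ^t* = N k.
  elim: k => [|k IH]; first by rewrite /N expr0 mulmx1.
  rewrite /N exprSr -mulmxE mulmxA -/(N k) trmxC_mul IH /N mulmxA -MA.
  by rewrite -!mulmxA mulmxE -exprS -exprSr.
have NS k : A ^t* *m N k = N k.+1 by rewrite /N mulmxA -MA -mulmxA mulmxE -exprS.
have kapr k : (kap k)^* = kap k.
  have -> : (kap k)^* = ((p ^t* *m N k *m p) ^t*) 0 0 by rewrite trmxC11.
  by rewrite 2!trmxC_mul trmxCK Nh mulmxA.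
have -> : M *m (A *m A - 1%:M) = N 2 - N 0.
  by rewrite mulmxBr /N expr2 expr0 !mulmxE !mulr1.
have -> : A ^t* *m M *m A - M = N 2 - N 0.
  by rewrite -MA -mulmxA /N expr2 expr0 !mulmxE !mulr1.
have -> : (z *: p - A *m p) ^t* = z^* *: p ^t* - p ^t* *m A ^t*.
  by rewrite linearB /= map_mxB linearZ /= map_mxZ trmxC_mul.
have -> : ((z^* *: p ^t* - p ^t* *m A ^t*) *m (N 2 - N 0) *m p) 0 0
   = z^* * (kap 2 - kap 0) - (kap 3 - kap 1).
  rewrite mulmxBl -(mulmxA _ (A ^t*)) [A ^t* *m _]mulmxBr !NS.
  by rewrite -scalemxAl mulmxBl -scalemxAl !mulmxBr !mulmxBl !(mx11B, mx11Z).
have -> : (p ^t* *m (N 2 - N 0) *m p) 0 0 = kap 2 - kap 0.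
  by rewrite mulmxBr mulmxBl mx11B.
rewrite !(rmorphB, rmorphM) /= !kapr conjCK [in RHS]ImE.
have i2 : 'i * 'i = -1 :> K by rewrite -expr2 sqrCi.
by field.
Qed.

Lemma form_antihermitian (K : numClosedFieldType) r (N E : 'M[K]_r) (v : 'cV[K]_r) :
  E ^t* = E ->
  (v ^t* *m ((N + E) - (N + E) ^t*) *m v) 0 0
  = (v ^t* *m N *m v) 0 0 - ((v ^t* *m N *m v) 0 0)^*.
Proof.
move=> Eh; have -> : N + E - (N + E) ^t* = N - N ^t*.
  by rewrite linearD /= map_mxD Eh opprD addrACA subrr addr0.
rewrite mulmxBr mulmxBl mx11B; congr (_ - _).
by rewrite -trmxC11 !trmxC_mul trmxCK mulmxA.
Qed.

Lemma notunit_ker (K : fieldType) n (M : 'M[K]_n) :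
  M \notin unitmx -> exists2 v : 'cV[K]_n, v != 0 & M *m v = 0.
Proof.
rewrite -unitmx_tr -row_free_unit -kermx_eq0 => /rowV0Pn[u /sub_kermxP e u0].
exists u^T; first by rewrite trmx_eq0.
by apply: trmx_inj; rewrite trmx_mul trmxK e trmx0.
Qed.

Variables (R : realType) (m n : nat) (G : 'M[{fraction {poly R}}]_m).
Variables (A : 'M[R]_n) (B : 'M[R]_(n, m)) (C : 'M[R]_(m, n)) (D : 'M[R]_m).
Local Notation cpoly := (map_poly (real_complex R)).

Lemma cmx_tr p q (M : 'M[R]_(p, q)) : (cmx M) ^t* = cmx M^T.
Proof. by apply/matrixP=> i j; rewrite !mxE conj_Creal ?complex_real. Qed.

Lemma cmxM p q r (M : 'M[R]_(p, q)) (N : 'M[R]_(q, r)) :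
  cmx (M *m N) = cmx M *m cmx N.
Proof. exact: map_mxM. Qed.

(** At an eigenvector for z, X - A^T X A takes the value (1 - |z|^2) v^* X v. *)
Lemma stein_stable (X : 'M[R]_n) z :
  pdmx (cmx X) -> psdmx (cmx (X - A^T *m X *m A)) ->
  1 < `|z| -> (cpoly (char_poly A)).[z] != 0.
Proof.
move=> [_ Xpd] [_ Q] z1; apply/negP => /eqP r0.
have /notunit_ker [v v0 Av] : z%:M - cmx A \notin unitmx.
  rewrite unitmxE -map_char_poly_mx_at det_map_mx unitfE negbK.
  by apply/eqP; exact: r0.
have e : cmx A *m v = z *: v.
  by move/eqP: Av; rewrite mulmxBl mul_scalar_mx subr_eq0 => /eqP.
have q0 := Xpd v v0; have := Q v.
rewrite /cmx map_mxB -!/(cmx _) !cmxM -cmx_tr mulmxBr mulmxBl mx11B.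
have -> : v ^t* *m ((cmx A) ^t* *m cmx X *m cmx A) *m v
   = (cmx A *m v) ^t* *m cmx X *m (cmx A *m v) by rewrite trmxC_mul !mulmxA.
rewrite e; have -> : (z *: v) ^t* = z^* *: v ^t* by rewrite linearZ /= map_mxZ.
rewrite -scalemxAr -!scalemxAl !mx11Z mulrA -normCK.
rewrite -[X in X - _]mul1r -mulrBl pmulr_lge0 // subr_ge0 expr_le1 //.
by move=> /le_lt_trans/(_ z1); rewrite ltxx.
Qed.

Lemma unitmx_opp (K : comUnitRingType) r (M : 'M[K]_r) : (- M \in unitmx) = (M \in unitmx).
Proof. by rewrite -scaleN1r unitmxZ // unitrN unitr1. Qed.

Lemma conj_reval (f : {fraction {poly R}}) z : reval f z^* = (reval f z)^*.
Proof.
have cp (p : {poly R}) : (cpoly p).[z^*] = ((cpoly p).[z])^*.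
  rewrite -horner_map -map_poly_comp; congr (_.[_]); apply: eq_map_poly => x /=.
  by rewrite conj_Creal // complex_real.
by rewrite /reval !cp fmorph_div.
Qed.

Hypothesis G_sym : G^T = G.
Hypothesis G_real : realization A B C D G.
Hypothesis reach : reachable A B.
Hypothesis obs : observable A C.
Hypothesis dA1 : \det (1%:M + A) != 0.
Hypothesis dA2 : \det (1%:M - A) != 0.

Lemma unit_ap1 : A + 1%:M \in unitmx.
Proof. by rewrite addrC unitmxE unitfE. Qed.

Lemma unit_am1 : A - 1%:M \in unitmx.
Proof. by rewrite -opprB unitmx_opp unitmxE unitfE. Qed.

(** With T the symmetrizer, M = T (A - I) (A + I)^-1 is symmetric, makes A
    self-adjoint, and the output equation for X says that it agrees with - X on
    the range of b. *)
Lemma gram_indefinite (X : 'M[R]_n) (b : 'M[R]_(n, m)) :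
  (A - 1%:M) *m b = B -> X = X^T ->
  C = - (B^T *m invmx (A^T - 1%:M) *m X *m (A + 1%:M)) ->
  exists M : 'M[R]_n, [/\ M \in unitmx, M^T = M, M *m A = A^T *m M,
    M *m b = - (X *m b) & C = b^T *m M *m (A + 1%:M)].
Proof.
move=> bE Xsym CE.
have [_ msym] := symmetric_markov G_sym G_real.
have [T [Tu Tsym TA TB]] := symmetrizer_exists reach obs msym.
have p1 := unit_ap1; have m1 := unit_am1.
have bT : b^T = B^T *m invmx (A^T - 1%:M).
  have -> : A^T - 1%:M = (A - 1%:M)^T by rewrite raddfB /= tr_scalar_mx.
  by rewrite -bE trmx_mul mulmxK // unitmx_tr.
have TA1 : T *m (A + 1%:M) = (A + 1%:M)^T *m T.
  by rewrite [(_ + _)^T]raddfD /= tr_scalar_mx mulmxDr mulmxDl TA mulmx1 mul1mx.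
have TA2 : T *m (A - 1%:M) = (A - 1%:M)^T *m T.
  by rewrite [(_ - _)^T]raddfB /= tr_scalar_mx mulmxBr mulmxBl TA mulmx1 mul1mx.
have com : (A + 1%:M) *m (A - 1%:M) = (A - 1%:M) *m (A + 1%:M).
  rewrite mulmxBr mulmxBl mulmx1 mul1mx.
  by rewrite mulmxDl mulmxDr mulmx1 mul1mx.
pose M := T *m (A - 1%:M) *m invmx (A + 1%:M).
have Mp1 : M *m (A + 1%:M) = T *m (A - 1%:M) by rewrite mulmxKV.
have Mu : M \in unitmx by rewrite !unitmx_mul Tu m1 unitmx_inv.
clearbody M.
have Msym : M^T = M.
  apply: (can_inj (mulmxK p1)); rewrite Mp1.
  apply: (can_inj (mulKmx (_ : (A + 1%:M)^T \in unitmx))); first by rewrite unitmx_tr.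
  rewrite mulmxA -trmx_mul Mp1 trmx_mul Tsym -TA2 mulmxA -TA1 -!mulmxA.
  by rewrite com.
have MA : M *m A = A^T *m M.
  apply: (can_inj (mulmxK p1)); rewrite -!mulmxA.
  have -> : A *m (A + 1%:M) = (A + 1%:M) *m A.
    by rewrite mulmxDl mulmxDr mulmx1 mul1mx.
  rewrite (mulmxA M) Mp1 -mulmxA.
  have -> : (A - 1%:M) *m A = A *m (A - 1%:M).
    by rewrite mulmxBl mulmxBr mulmx1 mul1mx.
  by rewrite mulmxA TA -mulmxA.
have CM : C = b^T *m M *m (A + 1%:M).
  rewrite -mulmxA Mp1 TA2 mulmxA -trmx_mul bE -[T]Tsym -trmx_mul TB.
  by rewrite trmxK.
have bM : b^T *m M = - (b^T *m X).
  apply: (can_inj (mulmxK p1)).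
  by rewrite -CM CE bT mulNmx.
exists M; split=> //.
by apply: trmx_inj; rewrite linearN /= (trmx_mul M) (trmx_mul X) Msym -Xsym bM.
Qed.

Theorem D_NI_sufficient (X : 'M[R]_n) : D = D^T ->
  X = X^T -> pdmx (cmx X) -> psdmx (cmx (X - A^T *m X *m A)) ->
  C = - (B^T *m invmx (A^T - 1%:M) *m X *m (A + 1%:M)) ->
  D_NI G.
Proof.
move=> Dsym Xsym Xpd XQ CE.
have stab z : 1 < `|z| -> (cpoly (char_poly A)).[z] != 0.
  exact: stein_stable Xpd XQ.
split.
  move=> i j z z1; have np := pole_frac (realization_frac G_real i j) (stab z z1).
  split=> //; have -> : (reval (G i j) : R[i]^o -> R[i]^o)
    = (horner (cpoly (rnum (G i j))) : R[i]^o -> R[i]^o)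
      * (fun w => (horner (cpoly (rden (G i j))) w)^-1) by apply/funext.
  apply: derivableM; first exact: derivable_poly.
  by apply: derivableV => //; exact: derivable_poly.
move=> z z1 /=; have rz := stab z z1.
have zu := resolvent_at_unit rz.
have [b bE] : exists b, (A - 1%:M) *m b = B.
  by exists (invmx (A - 1%:M) *m B); rewrite mulKVmx // unit_am1.
have [M [Mu Msym MA Mb CM]] := gram_indefinite bE Xsym CE.
pose H := 'i *: (mxreval G z - (mxreval G z) ^t*); rewrite -/H.
have Hh : H ^t* = H.
  rewrite /H linearZ /= map_mxZ linearB /= map_mxB trmxCK conjCi scaleNr.
  by rewrite -scalerN opprB.
have key (v : 'cV[R[i]]_m) : exists2 kap, 0 <= kap &
    (v ^t* *m H *m v) 0 0 = 2 * 'Im z * kap.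
  pose p := invmx (z%:M - cmx A) *m (cmx b *m v).
  have fE : z *: p - cmx A *m p = cmx b *m v.
    by rewrite -mul_scalar_mx -mulmxBl mulKVmx.
  have MAc : cmx M *m cmx A = (cmx A) ^t* *m cmx M by rewrite cmx_tr -!cmxM MA.
  have Mh : cmx M \is hermsymmx by rewrite hermsymmxP cmx_tr Msym.
  exists ((p ^t* *m ((cmx A) ^t* *m cmx M *m cmx A - cmx M) *m p) 0 0).
    case: Xpd => Xh Xpos; case: XQ => _ Qpos.
    apply: (indefinite_form_ge0 Xh Xpos _ Mh _ MAc z1).
    - move=> w; have := Qpos w.
      by rewrite /cmx map_mxB -!/(cmx _) !cmxM -cmx_tr.
    - by rewrite /cmx map_unitmx.
    - rewrite fE !mulmxA -!cmxM Mb.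
      by rewrite /cmx map_mxN mulNmx.
  rewrite -(NI_form_identity z p Mh MAc) fE.
  have -> : (cmx b *m v) ^t* *m (cmx M *m (cmx A *m cmx A - 1%:M)) *m p
     = v ^t* *m (cmx C *m invmx (z%:M - cmx A) *m cmx B) *m v.
    rewrite trmxC_mul cmx_tr.
    have -> : cmx A *m cmx A - 1%:M = cmx (A + 1%:M) *m cmx (A - 1%:M).
      rewrite -!cmxM; have -> : 1%:M = cmx 1%:M :> 'M[R[i]]_n by rewrite /cmx map_mx1.
      rewrite /cmx -map_mxB; congr map_mx.
      by rewrite mulmxDl mul1mx mulmxBr mulmx1 addrA subrK.
    transitivity (v ^t* *m (cmx C *m cmx (A - 1%:M) *m p)).
      by rewrite {1}CM !cmxM !mulmxA.
    rewrite -[in RHS]mulmxA -[in RHS]mulmxA -[in RHS](mulmxA (cmx C)) -[in LHS](mulmxA (cmx C)).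
    suff -> : cmx (A - 1%:M) *m p = invmx (z%:M - cmx A) *m (cmx B *m v).
      by rewrite -[in RHS]mulmxA.
    apply: (can_inj (mulKmx zu)); rewrite mulKVmx // mulmxA.
    have -> : (z%:M - cmx A) *m cmx (A - 1%:M) = cmx (A - 1%:M) *m (z%:M - cmx A).
      rewrite mulmxBl mulmxBr mul_scalar_mx mul_mx_scalar; congr (_ - _).
      by rewrite -!cmxM mulmxBl mulmxBr mulmx1 mul1mx.
    by rewrite -mulmxA mulKVmx // mulmxA -cmxM bE.
  rewrite /H (mxreval_realization G_real rz) -scalemxAr -scalemxAl mx11Z; congr (_ * _).
  have Dh : (cmx D) ^t* = cmx D by rewrite cmx_tr -Dsym.
  exact: form_antihermitian.
split.
- move=> z0; split; first by rewrite hermsymmxP Hh.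
  by move=> v; have [k k0 ->] := key v; rewrite !mulr_ge0 // ltW.
- move=> z0; rewrite /H; apply/eqP; rewrite scaler_eq0 subr_eq0; apply/orP; right.
  apply/eqP/matrixP=> i j; rewrite !mxE -conj_reval.
  have -> : z^* = z by apply/CrealP/Creal_ImP.
  by rewrite -{1}G_sym mxE.
- move=> z0; split; first by rewrite hermsymmxP linearN /= map_mxN Hh.
  move=> v; have [k k0 e] := key v.
  have -> : (v ^t* *m - H *m v) 0 0 = - (v ^t* *m H *m v) 0 0.
    by rewrite mulmxN mulNmx [LHS]mxE.
  by rewrite e -mulNr -mulrN mulr_ge0 // mulr_ge0 // oppr_ge0 ltW.
Qed.
End Sufficiency.

(** * Infima of quadratic energies *)

Section QuadraticInfimum.
Variable R : realType.

(** The defect f t - t f(1) is additive and vanishes on the integers, so it is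
    bounded on the whole line, hence zero. *)
Lemma additive_bounded_linear (f : R -> R) (K : R) :
  (forall s t, f (s + t) = f s + f t) ->
  (forall t, 0 <= t <= 1 -> `|f t| <= K) ->
  forall t, f t = t * f 1.
Proof.
move=> fD fK t.
have f0 : f 0 = 0 by have := fD 0 0; rewrite addr0; lra.
have fN s : f (- s) = - f s by have := fD s (- s); rewrite subrr f0; lra.
have fn (k : nat) s : f (k%:R * s) = k%:R * f s.
  elim: k => [|k IH]; first by rewrite !mul0r f0.
  by rewrite -natr1 !mulrDl !mul1r fD IH.
have fz (k : int) : f k%:~R = k%:~R * f 1.
  case: k => k; first by rewrite -[k%:~R]mulr1 -pmulrn fn mulr1.
  by rewrite NegzE mulrNz fN -pmulrn -[_%:R]mulr1 fn mulNr mulr1.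
have bound (k : nat) : k%:R * `|f t - t * f 1| <= K + `|f 1|.
  rewrite -[k%:R]ger0_norm // -normrM mulrBr mulrA -fn.
  set s := k%:R * t; pose q : R := (Num.floor s)%:~R.
  have sq : 0 <= s - q <= 1.
    by rewrite subr_ge0 floor_le_tmp /= lerBlDl ltW // -(mulr1z 1) -intrD floorD1_gt.
  have -> : f s - s * f 1 = f (s - q) - (s - q) * f 1.
    by rewrite -{1}(subrK q s) fD fz; lra.
  rewrite (le_trans (ler_normB _ _)) // lerD ?fK //.
  rewrite normrM ler_piMl // ger0_norm; lra.
apply/eqP; rewrite -subr_eq0 -normr_eq0; apply/negPn/negP => n0.
have d0 : 0 < `|f t - t * f 1| by rewrite lt_def n0 normr_ge0.
have := bound (Num.truncn ((K + `|f 1|) / `|f t - t * f 1|)).+1.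
rewrite leNgt -ltr_pdivrMr // => /negP; apply; exact: truncnS_gt.
Qed.

Definition qform n (P : 'M[R]_n) (x : 'cV[R]_n) : R := (x^T *m P *m x) 0 0.

(** The infimum of a nonnegative quadratic energy over the inputs reaching x
    inherits the parallelogram law, hence (Jordan and von Neumann) is itself a
    quadratic form. The infimum need not be attained. *)
Lemma quadratic_infimum n (E : 'cV[R]_n -> R -> Prop) :
  (forall x, exists e, E x e) ->
  (forall x e, E x e -> 0 <= e) ->
  (forall c x e, E x e -> E (c *: x) (c ^+ 2 * e)) ->
  (forall x y e f, E x e -> E y f -> exists g h,
     [/\ E (x + y) g, E (x - y) h & g + h = 2 * e + 2 * f]) ->
  exists P : 'M[R]_n, [/\ P^T = P, forall x e, E x e -> qform P x <= e
    & forall x eps, 0 < eps -> exists2 e, E x e & e < qform P x + eps].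
Proof.
move=> Eex E0 EZ Epar.
pose V x := inf [set e | E x e]%classic.
have hasinf x : has_inf [set e | E x e]%classic.
  by split; [have [e] := Eex x; exists e | exists 0 => e /= /E0].
have Vle x e : E x e -> V x <= e by move=> xe; apply: ge_inf (hasinf x).2 _ xe.
have Vadh x eps : 0 < eps -> exists2 e, E x e & e < V x + eps.
  by move=> e0; have [e] := inf_adherent e0 (hasinf x); exists e.
have V0 x : 0 <= V x by apply: lb_le_inf; [have [] := hasinf x | move=> e /= /E0].
clearbody V.
have VZle c x : V (c *: x) <= c ^+ 2 * V x.
  apply/ler_addgt0Pr => eps eps0.
  have c1 : 0 < c ^+ 2 + 1 by rewrite ltr_wpDl // sqr_ge0.
  have [e Ee lte] := Vadh x (eps / (c ^+ 2 + 1)) (divr_gt0 eps0 c1).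
  apply: (le_trans (Vle _ _ (EZ c x e Ee))).
  apply: (@le_trans _ _ (c ^+ 2 * (V x + eps / (c ^+ 2 + 1)))).
    by rewrite ler_wpM2l ?sqr_ge0 // ltW.
  rewrite mulrDr lerD2l mulrCA ler_piMr ?(ltW eps0) //.
  by rewrite ler_pdivrMr // mul1r lerDl.
have Vpar_le x y : V (x + y) + V (x - y) <= 2 * V x + 2 * V y.
  apply/ler_addgt0Pr => eps eps0.
  have e4 : 0 < eps / 4 by rewrite divr_gt0.
  have [e Ee lte] := Vadh x _ e4; have [f Ef ltf] := Vadh y _ e4.
  have [g [h [Eg Eh gh]]] := Epar _ _ _ _ Ee Ef.
  have := Vle _ _ Eg; have := Vle _ _ Eh; lra.
have V2 x : V (2 *: x) = 4 * V x.
  have := VZle 2 x; have := VZle 2^-1 (2 *: x); rewrite scalerA mulVf ?pnatr_eq0 // scale1r.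
  lra.
have Vpar x y : V (x + y) + V (x - y) = 2 * V x + 2 * V y.
  have := Vpar_le x y; have := Vpar_le (x + y) (x - y).
  have -> : x + y + (x - y) = 2 *: x by rewrite addrACA subrr addr0 scaler_nat mulr2n.
  have -> : x + y - (x - y) = 2 *: y.
    by rewrite opprB [y - x]addrC addrACA subrr add0r scaler_nat mulr2n.
  rewrite !V2; lra.
have VN x : V (- x) = V x.
  have := VZle (-1) x; have := VZle (-1) (- x); rewrite !scaleN1r opprK; lra.
pose B x y := (V (x + y) - V (x - y)) / 4.
have BC x y : B x y = B y x by rewrite /B [y + x]addrC -(VN (y - x)) opprB.
have BN x y : B (- x) y = - B x y.
  rewrite /B -(VN (- x + y)) -(VN (- x - y)) !opprD !opprK; lra.
have BD x x' y : B (x + x') y = B x y + B x' y.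
  have half u u' : B (u + u') y + B (u - u') y = 2 * B u y.
    rewrite /B; have := Vpar (u + y) u'; have := Vpar (u - y) u'.
    rewrite ![u + u' + _]addrAC ![u - u' + _]addrAC; lra.
  have := half x x'; have := half x' x.
  rewrite [x' + x]addrC -(opprB x x') BN; lra.
have BZ t x y : B (t *: x) y = t * B x y.
  have := @additive_bounded_linear (fun s => B (s *: x) y) ((V x + V y) / 2) _ _ t.
  rewrite scale1r; apply=> [s s'|s /andP[s0 s1]]; first by rewrite scalerDl BD.
  have := Vpar (s *: x) y; have := VZle s x; have := V0 (s *: x + y).
  have := V0 (s *: x - y); have := V0 x; rewrite /B => v0 v1 v2 v3 v4.
  have s2 : s ^+ 2 * V x <= V x by rewrite ler_piMl // expr_le1.
  rewrite ler_norml; apply/andP; split; lra.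
have V00 : V 0 = 0 by have := VZle 0 0; have := V0 0; rewrite scale0r expr0n /=; lra.
have BV x : B x x = V x.
  by rewrite /B subrr V00 subr0 -mulr2n -scaler_nat V2; lra.
have B0 y : B 0 y = 0 by have := BZ 0 0 y; rewrite scaler0 mul0r.
have Bsum x y : B x y = \sum_i x i 0 * B (delta_mx i 0) y.
  rewrite {1}(matrix_sum_delta x).
  have -> : \sum_i \sum_(j < 1) x i j *: delta_mx i j = \sum_i x i 0 *: delta_mx i 0 :> 'cV[R]_n.
    by apply: eq_bigr => i _; rewrite big_ord1.
  rewrite (big_morph (fun u => B u y) (fun u v => BD u v y) (B0 y)).
  by apply: eq_bigr => i _; rewrite BZ.
exists (\matrix_(i, j) B (delta_mx i 0) (delta_mx j 0)).
have qV x : qform (\matrix_(i, j) B (delta_mx i 0) (delta_mx j 0)) x = V x.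
  rewrite -BV Bsum /qform -mulmxA mxE; apply: eq_bigr => i _; rewrite mxE; congr (_ * _).
  by rewrite mxE BC Bsum; apply: eq_bigr => j _; rewrite mxE mulrC BC.
split=> [|x e|x eps].
- by apply/matrixP=> i j; rewrite !mxE BC.
- by rewrite qV; exact: Vle.
- by rewrite qV; exact: Vadh.
Qed.
End QuadraticInfimum.

(** * From a storage function to the output equation *)

Section StorageAlgebra.
Variable R : realType.

Definition bil p q (M : 'M[R]_(p, q)) (x : 'cV[R]_p) (y : 'cV[R]_q) : R :=
  (x^T *m M *m y) 0 0.

Lemma bilDl p q (M : 'M[R]_(p, q)) x x' y :
  bil M (x + x') y = bil M x y + bil M x' y.
Proof. by rewrite /bil linearD /= !mulmxDl mx11D. Qed.

Lemma bilDr p q (M : 'M[R]_(p, q)) x y y' :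
  bil M x (y + y') = bil M x y + bil M x y'.
Proof. by rewrite /bil mulmxDr mx11D. Qed.

Lemma bilZl p q (M : 'M[R]_(p, q)) t x y : bil M (t *: x) y = t * bil M x y.
Proof. by rewrite /bil linearZ /= -!scalemxAl mx11Z. Qed.

Lemma bilZr p q (M : 'M[R]_(p, q)) t x y : bil M x (t *: y) = t * bil M x y.
Proof. by rewrite /bil -scalemxAr mx11Z. Qed.

Lemma bilNl p q (M : 'M[R]_(p, q)) x y : bil M (- x) y = - bil M x y.
Proof. by rewrite -scaleN1r bilZl mulN1r. Qed.

Lemma bilNr p q (M : 'M[R]_(p, q)) x y : bil M x (- y) = - bil M x y.
Proof. by rewrite -scaleN1r bilZr mulN1r. Qed.

Lemma bil0l p q (M : 'M[R]_(p, q)) y : bil M 0 y = 0.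
Proof. by rewrite -(scale0r 0) bilZl mul0r. Qed.

Lemma bil0r p q (M : 'M[R]_(p, q)) x : bil M x 0 = 0.
Proof. by rewrite -(scale0r 0) bilZr mul0r. Qed.

Definition bilE := (bilDl, bilDr, bilZl, bilZr, bilNl, bilNr).

Lemma bil_mulmxl p q r (M : 'M[R]_(p, q)) (N : 'M[R]_(p, r)) x y :
  bil M (N *m x) y = bil (N^T *m M) x y.
Proof. by rewrite /bil trmx_mul !mulmxA. Qed.

Lemma bil_tr p q (M : 'M[R]_(p, q)) x y : bil M^T y x = bil M x y.
Proof.
have -> : bil M x y = ((x^T *m M *m y)^T) 0 0 by rewrite mxE.
by rewrite !trmx_mul trmxK mulmxA.
Qed.

Lemma bil_eq p q (M N : 'M[R]_(p, q)) :
  (forall x y, bil M x y = bil N x y) -> M = N.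
Proof.
move=> e; apply/matrixP=> i j; have := e (delta_mx i 0) (delta_mx j 0).
by rewrite /bil !trmx_delta -!rowE -!colE !mxE.
Qed.

Lemma affine_ge0 (a c : R) : (forall t, 0 <= t * a + c) -> a = 0.
Proof.
move=> h; apply/eqP; apply: contraT => a0.
have := h (- (c + 1) / a); rewrite -mulrA mulVf // mulr1; lra.
Qed.

Lemma quadratic_ge0 (a c : R) : (forall t, 0 <= t * a + t ^+ 2 * c) -> a = 0.
Proof.
move=> h; apply/eqP; apply: contraT => a0.
(* At t = - a / d the quadratic term cannot outweigh the linear one. *)
pose d := `|c| + 1; have d0 : 0 < d by rewrite ltr_wpDl.
have := h (- a / d); have cd : c < d by rewrite /d ltr_pwDr // ler_norm.
have -> : - a / d * a + (- a / d) ^+ 2 * c = (a / d) ^+ 2 * (c - d) by field; lra.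
rewrite pmulr_rge0; first lra.
by rewrite exprn_even_gt0 //= mulf_neq0 // invr_neq0 // gt_eqF.
Qed.

Variables (m n : nat).
Variables (A : 'M[R]_n) (B b : 'M[R]_(n, m)) (C : 'M[R]_(m, n)).
Hypothesis bE : (A - 1%:M) *m b = B.
Hypothesis p1 : A + 1%:M \in unitmx.
Hypothesis m1 : A - 1%:M \in unitmx.

(** In the coordinate r = xi + b w the dynamics and the supply depend only on
    the increment v of the input w. Along w = t c the dissipation inequality is
    affine in t, so its slope vanishes; this determines the part of the storage
    that involves w, and removing it leaves a storage in r alone. *)
Lemma storage_incremental (P : 'M[R]_(n + m)) : P^T = P ->
  (forall xi w w', qform P (col_mx (A *m xi + B *m w) w')
     <= qform P (col_mx xi w)
        + bil C w' (A *m (A *m xi + B *m w) + B *m w' - xi)) ->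
  exists X0 : 'M[R]_n, [/\ X0^T = X0,
    (forall r, qform X0 r = qform P (col_mx r 0))
    & forall r v, qform X0 (A *m r + b *m v)
        <= qform X0 r - bil C v (A *m r + b *m v + r)].
Proof.
move=> Psym diss.
(* Change of variables from (r, w) to (xi, w). *)
pose S : 'M[R]_(n + m) := block_mx 1%:M (- b) 0 1%:M.
pose P' := S^T *m P *m S.
have P'sym : P'^T = P' by rewrite !trmx_mul trmxK Psym mulmxA.
have SE r w : S *m col_mx r w = col_mx (r - b *m w) w.
  by rewrite mul_block_col !mul1mx mul0mx add0r mulNmx.
have P'E r w : qform P (col_mx (r - b *m w) w) = qform P' (col_mx r w).
  by rewrite -SE /qform trmx_mul !mulmxA.
pose X0 := ulsubmx P'; pose L := ursubmx P'; pose N := drsubmx P'.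
have X0sym : X0^T = X0 by rewrite trmx_ulsub P'sym.
have Nsym : N^T = N by rewrite trmx_drsub P'sym.
have QE r w : qform P' (col_mx r w) = bil X0 r r + 2 * bil L r w + bil N w w.
  have -> : qform P' (col_mx r w) = bil X0 r r + bil L r w + (bil L^T w r + bil N w w).
    rewrite /qform /bil -{1}[P']submxK tr_col_mx mul_row_block mul_row_col.
    rewrite !mulmxDl !mx11D /L trmx_ursub P'sym -/X0 -/L -/N.
    by rewrite addrACA.
  by rewrite bil_tr; ring.
have inc r v w : qform P' (col_mx (A *m r + b *m v) (w + v))
   <= qform P' (col_mx r w) + bil C (w + v) (A *m (A *m r + b *m v) - r - b *m v).
  have Bw u : B *m u = A *m (b *m u) - b *m u.
    by rewrite -bE -mulmxA mulmxBl mul1mx.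
  have e1 : A *m (r - b *m w) + B *m w = A *m r + b *m v - b *m (w + v).
    by rewrite Bw mulmxBr mulmxDr opprD !addrA subrK [RHS]addrAC addrK.
  rewrite -!P'E -e1 (le_trans (diss _ _ _)) // lerD2l e1.
  have -> : A *m (A *m r + b *m v - b *m (w + v)) + B *m (w + v) - (r - b *m w)
     = A *m (A *m r + b *m v) - r - b *m v => //.
  rewrite Bw mulmxBr; move: (A *m (A *m r + b *m v)) (A *m (b *m (w + v))) => x y.
  rewrite mulmxDr; move: (b *m w) (b *m v) => bw bv.
  by apply/matrixP=> i j; rewrite !mxE; ring.
(* The slope in t of the inequality along w = t c. *)
have aff r v c : 2 * bil L (A *m r + b *m v) c + 2 * bil N c v - 2 * bil L r c
    = bil C c (A *m (A *m r + b *m v) - r - b *m v).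
  set r' := A *m r + b *m v; set s := A *m r' - r - b *m v.
  apply/esym/eqP; rewrite -subr_eq0; apply/eqP.
  apply: (@affine_ge0 _ (bil X0 r r + bil C v s - bil X0 r' r' - 2 * bil L r' v - bil N v v)) => t.
  have := inc r v (t *: c); rewrite -/r' -/s !QE !bilE -(bil_tr N v c) Nsym.
  lra.
have L2 r c : 2 * bil L r c = bil C c ((A + 1%:M) *m r).
  have e y : 2 * bil L ((A - 1%:M) *m y) c = bil C c ((A + 1%:M) *m ((A - 1%:M) *m y)).
    have := aff y 0 c; rewrite !mulmx0 !addr0 !subr0.
    rewrite bil0r.
    rewrite !mulmxBl !mul1mx mulmxDl !mulmxBr !mul1mx !bilE; lra.
  by have := e (invmx (A - 1%:M) *m r); rewrite mulKVmx.
have N2 v : bil N v v = - bil C v (b *m v).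
  have := aff 0 v v; rewrite mulmx0 add0r subr0.
  rewrite bil0l.
  rewrite L2 mulmxDl mul1mx !bilE; lra.
exists X0; split=> // [r|r v].
  have -> : col_mx r (0 : 'cV_m) = col_mx (r - b *m 0) 0 by rewrite mulmx0 subr0.
  by rewrite P'E QE !bil0r mulr0 !addr0.
have := inc r v 0; rewrite add0r !QE.
have := L2 (A *m r + b *m v) v; rewrite [(A + _) *m _]mulmxDl mul1mx.
have := N2 v; rewrite !bil0r !bilE /qform -!/(bil _ _ _) !bilE.
lra.
Qed.

(** When b v = - (A + I) r the state jumps from r to - r and no energy is
    exchanged, so the dissipation inequality is an equality there. Its first
    variation must vanish, which is the output equation. *)
Lemma storage_output (X0 : 'M[R]_n) : X0^T = X0 ->
  (forall r v, qform X0 (A *m r + b *m v)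
     <= qform X0 r - bil C v (A *m r + b *m v + r)) ->
  C = - (b^T *m (2 *: (invmx (A + 1%:M)^T *m X0 *m invmx (A + 1%:M))) *m (A + 1%:M)).
Proof.
move=> X0sym diss.
have key v s : bil C v ((A + 1%:M) *m s)
   = - 2 * bil X0 (invmx (A + 1%:M) *m (b *m v)) ((A + 1%:M) *m s).
  set q := invmx (A + 1%:M) *m (b *m v).
  have Aq : A *m q = b *m v - q.
    by have := mulKVmx p1 (b *m v); rewrite -/q mulmxDl mul1mx => <-; rewrite addrK.
  apply/eqP; rewrite -subr_eq0 mulNr opprK; apply/eqP.
  rewrite -[LHS]opprK; apply/eqP; rewrite oppr_eq0; apply/eqP.
  apply: (@quadratic_ge0 _ (bil X0 s s - bil X0 (A *m s) (A *m s))) => t.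
  have := diss (- q + t *: s) v.
  rewrite mulmxDr mulmxN Aq opprB -scalemxAr.
  have -> : q - b *m v + t *: (A *m s) + b *m v = q + t *: (A *m s).
    by rewrite addrAC subrK.
  have -> : q + t *: (A *m s) + (- q + t *: s) = t *: ((A + 1%:M) *m s).
    by rewrite addrACA subrr add0r mulmxDl mul1mx scalerDr.
  rewrite /qform -!/(bil _ _ _) mulmxDl mul1mx !bilE.
  rewrite -(bil_tr X0 q s) -(bil_tr X0 q (A *m s)) X0sym.
  lra.
apply: bil_eq => v y; have := key v (invmx (A + 1%:M) *m y); rewrite mulKVmx // => ->.
rewrite bil_mulmxl bil_mulmxl trmx_inv; set Y := invmx (A + 1%:M)^T *m X0.
rewrite -scalemxAr -scalemxAl -mulmxA mulmxKV // /bil mulmxN -scalemxAr.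
by rewrite !mulNmx -scalemxAl -scaleNr mx11Z.
Qed.
End StorageAlgebra.

(** * Construction of the storage matrix *)

Lemma symmetric_form_split (K : numClosedFieldType) n (M : 'M[K]_n) (x y : 'cV[K]_n) :
  M^T = M ->
  ((x^T - 'i *: y^T) *m M *m (x + 'i *: y)) 0 0
  = (x^T *m M *m x) 0 0 + (y^T *m M *m y) 0 0.
Proof.
move=> Ms; have yx : (y^T *m M *m x) 0 0 = (x^T *m M *m y) 0 0.
  have <- : ((y^T *m M *m x)^T) 0 0 = (y^T *m M *m x) 0 0 by rewrite mxE.
  by rewrite !trmx_mul trmxK Ms mulmxA.
rewrite !mulmxBl !mulmxDr -!scalemxAl -!scalemxAr !(mx11B, mx11D, mx11Z) yx.
rewrite ['i * ('i * _)]mulrA -expr2 sqrCi; ring.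
Qed.

Section RealForms.
Local Open Scope sesquilinear_scope.
Variables (R : realType) (n : nat) (X : 'M[R]_n).
Hypothesis X_sym : X^T = X.

(** At x + i y the cross terms cancel by symmetry. *)
Lemma cmx_form (v : 'cV[R[i]]_n) : exists x y : 'cV[R]_n,
  v = cmx x + 'i *: cmx y /\
  (v ^t* *m cmx X *m v) 0 0 = (qform X x + qform X y)%:C%C.
Proof.
exists (map_mx (@complex.Re R) v), (map_mx (@complex.Im R) v).
set x := map_mx _ v; set y := map_mx _ v.
have vE : v = cmx x + 'i *: cmx y.
  by apply/matrixP=> i j; rewrite !mxE; case: (v i j) => a c; simpc.
split=> //.
have vs : v ^t* = (cmx x)^T - 'i *: (cmx y)^T.
  by apply/matrixP=> i j; rewrite !mxE; case: (v j i) => a c; simpc.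
have form p : ((cmx p)^T *m cmx X *m cmx p) 0 0 = (qform X p)%:C%C.
  by rewrite /cmx map_trmx -2!map_mxM mxE.
rewrite vs vE symmetric_form_split ?form ?rmorphD //.
by rewrite /cmx map_trmx X_sym.
Qed.

Lemma cmx_hermsym : cmx X \is hermsymmx.
Proof. by rewrite hermsymmxP cmx_tr X_sym. Qed.

Lemma psdmx_cmx : (forall x, 0 <= qform X x) -> psdmx (cmx X).
Proof.
move=> X0; split=> [|v]; first exact: cmx_hermsym.
have [x [y [_ ->]]] := cmx_form v.
by rewrite lecR addr_ge0.
Qed.

Lemma pdmx_cmx : (forall x, x != 0 -> 0 < qform X x) -> pdmx (cmx X).
Proof.
move=> X0; split=> [|v v0]; first exact: cmx_hermsym.
have q0 x : 0 <= qform X x.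
  have [->|/X0/ltW //] := eqVneq x 0.
  by rewrite /qform -/(bil X 0 0) bil0r.
have [x [y [e ->]]] := cmx_form v; rewrite ltcR.
have [x0|/X0 xp] := eqVneq x 0; last by rewrite ltr_wpDr.
have [y0|/X0 yp] := eqVneq y 0; last by rewrite ltr_wpDl.
by move: v0; rewrite e x0 y0 /cmx !map_mx0 scaler0 addr0 eqxx.
Qed.

(** A zero of a nonnegative form is a minimum, so the derivative vanishes. *)
Lemma qform_eq0 : (forall x, 0 <= qform X x) ->
  forall x, qform X x = 0 -> X *m x = 0.
Proof.
move=> X0 x qx; apply/matrixP=> i j; rewrite [j]ord1 [RHS]mxE.
have <- : bil X (delta_mx i 0) x = (X *m x) i 0.
  by rewrite /bil trmx_delta -mulmxA -rowE mxE.
have two : 2 * bil X (delta_mx i 0) x = 0.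
  apply: (@quadratic_ge0 _ _ (qform X (delta_mx i 0))) => t.
  have := X0 (x + t *: delta_mx i 0); move: qx.
  rewrite /qform -!/(bil _ _ _) !bilE -(bil_tr X x (delta_mx i 0)) X_sym; lra.
lra.
Qed.
End RealForms.

Section Storage.
Variables (R : realType) (m n : nat).
Variables (A : 'M[R]_n) (B : 'M[R]_(n, m)) (C : 'M[R]_(m, n)).
Implicit Type l : seq 'cV[R]_m.

(** For s = 1 this is the energy sum_k w_k^T C (x_(k+1) - x_(k-1)) absorbed by
    the system started at rest: [state l] is x_(k+1) when w_k heads l, and the
    state of [behead l'] is x_(k-1). Other values of s weigh the past
    geometrically; s = |z|^2 arises on the circle through z. *)
Fixpoint energy (s : R) l : R :=
  if l is w :: l' then
    s * energy s l' + bil C w (state A B l - s *: state A B (behead l'))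
  else 0.

Lemma state_nseq0 k : state A B (nseq k 0) = 0.
Proof. by elim: k => [//|k IH] /=; rewrite IH !mulmx0 addr0. Qed.

Lemma energy_cat0 s l k : energy s (l ++ nseq k 0) = energy s l.
Proof.
elim: l => [|w l IH] /=.
  by elim: k => [//|k IH] /=; rewrite IH bil0l mulr0 addr0.
rewrite IH state_cat0; congr (_ + bil C w (_ - s *: _)).
case: l {IH} => [|w' l] /=; last by rewrite state_cat0.
by case: k => [//|k] /=; rewrite state_nseq0.
Qed.

Lemma state_scale c l : state A B [seq c *: w | w <- l] = c *: state A B l.
Proof.
have := state_map A B l c 0 id id; rewrite scale0r addr0 map_id => <-.
by congr state; apply: eq_map => w; rewrite scale0r addr0.
Qed.

Lemma stateD T (t : seq T) (f g : T -> 'cV[R]_m) :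
  state A B [seq f x + g x | x <- t]
  = state A B (map f t) + state A B (map g t).
Proof.
have := state_map A B t 1 1 f g; rewrite !scale1r => <-.
by congr state; apply: eq_map => x; rewrite !scale1r.
Qed.

Lemma stateB T (t : seq T) (f g : T -> 'cV[R]_m) :
  state A B [seq f x - g x | x <- t]
  = state A B (map f t) - state A B (map g t).
Proof.
have := state_map A B t 1 (-1) f g; rewrite scale1r scaleN1r => <-.
by congr state; apply: eq_map => x; rewrite scale1r scaleN1r.
Qed.

Lemma energy_scale s c l : energy s [seq c *: w | w <- l] = c ^+ 2 * energy s l.
Proof.
elim: l => [|w l IH] /=; first by rewrite mulr0.
rewrite IH behead_map !state_scale -!scalemxAr -scalerDr scalerA.
by rewrite [s * c]mulrC -scalerA -scalerBr bilZl bilZr; ring.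
Qed.

Lemma energy_parallelogram s T (t : seq T) (f g : T -> 'cV[R]_m) :
  energy s [seq f x + g x | x <- t] + energy s [seq f x - g x | x <- t]
  = 2 * energy s (map f t) + 2 * energy s (map g t).
Proof.
elim: t => [|x t IH] /=; first by rewrite !mulr0 addr0.
rewrite !behead_map !stateB !stateD !mulmxDr !mulmxN !bilE.
move: IH; set E1 := energy s _; set E2 := energy s _.
set E3 := energy s _; set E4 := energy s _ => IH.
have -> : E1 = 2 * E3 + 2 * E4 - E2 by rewrite -IH addrK.
ring.
Qed.

Hypothesis reach : reachable A B.
Hypothesis passive : forall l, 0 <= energy 1 l.

(** Least energy needed to reach the state xi with w as last input. Prolonging an
    input by w' costs exactly the supply of that step. *)
Lemma required_supply : exists P : 'M[R]_(n + m), [/\ P^T = P,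
  (forall x, 0 <= qform P x) &
  forall xi w w', qform P (col_mx (A *m xi + B *m w) w')
     <= qform P (col_mx xi w)
        + bil C w' (A *m (A *m xi + B *m w) + B *m w' - xi)].
Proof.
pose E (x : 'cV[R]_(n + m)) e := exists l w,
  x = col_mx (state A B l) w /\ e = energy 1 (w :: l).
have [||||P [Psym Ple Padh]] := @quadratic_infimum R _ E.
- move=> x; have [l e] := reach (usubmx x).
  by exists (energy 1 (dsubmx x :: l)), l, (dsubmx x); rewrite e vsubmxK.
- by move=> x e [l [w [_ ->]]].
- move=> c x e [l [w [-> ->]]].
  exists [seq c *: u | u <- l], (c *: w).
  by rewrite -energy_scale scale_col_mx state_scale.
- move=> x y e f [l [w [-> ->]]] [l' [w' [-> ->]]].
  (* Padding with zeros in the past gives both inputs the same length. *)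
  pose t := zip (l ++ nseq (size l') 0) (l' ++ nseq (size l) 0).
  have sz : size (l ++ nseq (size l') 0) = size (l' ++ nseq (size l) 0).
    by rewrite !size_cat !size_nseq addnC.
  have t1 : map fst t = l ++ nseq (size l') 0 by apply: unzip1_zip; rewrite sz.
  have t2 : map snd t = l' ++ nseq (size l) 0 by apply: unzip2_zip; rewrite sz.
  exists (energy 1 [seq u.1 + u.2 | u <- (w, w') :: t]).
  exists (energy 1 [seq u.1 - u.2 | u <- (w, w') :: t]); split.
  + exists [seq u.1 + u.2 | u <- t], (w + w'); split=> //.
    by rewrite stateD t1 t2 !state_cat0 add_col_mx.
  + exists [seq u.1 - u.2 | u <- t], (w - w'); split=> //.
    by rewrite stateB t1 t2 !state_cat0 opp_col_mx add_col_mx.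
  rewrite -(energy_cat0 1 (w :: l) (size l')) -(energy_cat0 1 (w' :: l') (size l)).
  by rewrite energy_parallelogram !map_cons t1 t2 !cat_cons.
exists P; split=> // [x|xi w w'].
  by apply/ler_addgt0Pr => eps /(Padh x)[e [l [w [_ ->]]] /ltW]; exact: le_trans.
apply/ler_addgt0Pr => eps /(Padh (col_mx xi w))[e [l [u [/eq_col_mx[xE wE] ->]]] lt].
apply: (@le_trans _ _ (energy 1 [:: w', u & l])).
  by apply: Ple; exists (u :: l), w'; rewrite /= xE wE.
have -> : energy 1 [:: w', u & l] = energy 1 (u :: l)
    + bil C w' (A *m (A *m xi + B *m w) + B *m w' - xi).
  rewrite xE wE -[LHS]/(1 * energy 1 (u :: l)
    + bil C w' (state A B [:: w', u & l] - 1 *: state A B l)).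
  by rewrite mul1r scale1r.
by rewrite [leRHS]addrAC lerD2r ltW.
Qed.

Hypothesis obs : observable A C.
Hypothesis p1 : A + 1%:M \in unitmx.
Hypothesis m1 : A - 1%:M \in unitmx.

(** The required supply gives a storage, [storage_output] the output equation.
    Definiteness comes from observability: the kernel of X is invariant under A
    by the Stein inequality and C vanishes on it by the output equation. *)
Lemma storage_exists : exists X : 'M[R]_n,
  [/\ X = X^T, pdmx (cmx X), psdmx (cmx (X - A^T *m X *m A))
    & C = - (B^T *m invmx (A^T - 1%:M) *m X *m (A + 1%:M))].
Proof.
pose b := invmx (A - 1%:M) *m B.
have bE : (A - 1%:M) *m b = B by rewrite mulKVmx.
have [P [Psym P0 Pdiss]] := required_supply.
have [X0 [X0sym X0E X0diss]] := storage_incremental bE m1 Psym Pdiss.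
pose Y := invmx (A + 1%:M); pose X := 2 *: (Y^T *m X0 *m Y).
have CE : C = - (b^T *m X *m (A + 1%:M)).
  by rewrite {1}(storage_output p1 X0sym X0diss) /X /Y trmx_inv.
have Xsym : X^T = X by rewrite /X linearZ /= !trmx_mul trmxK X0sym mulmxA.
have Xq x : qform X x = 2 * qform X0 (Y *m x).
  by rewrite /qform /X -scalemxAr -scalemxAl mx11Z trmx_mul !mulmxA.
have X_ge0 x : 0 <= qform X x by rewrite Xq X0E mulr_ge0.
have AY x : Y *m (A *m x) = A *m (Y *m x).
  apply: (can_inj (mulKmx p1)); rewrite mulKVmx // mulmxA.
  have -> : (A + 1%:M) *m A = A *m (A + 1%:M).
    by rewrite mulmxDl mulmxDr mulmx1 mul1mx.
  by rewrite -mulmxA mulKVmx.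
have XA x : qform X (A *m x) <= qform X x.
  have := X0diss (Y *m x) 0.
  by rewrite mulmx0 addr0 bil0l subr0 -AY !Xq; lra.
have Xker := qform_eq0 Xsym X_ge0.
have X_gt0 x : x != 0 -> 0 < qform X x.
  move=> x0; rewrite lt_def X_ge0 andbT; apply: contraNneq x0 => qx; apply/eqP.
  have qA k : qform X (A ^+ k *m x) = 0.
    elim: k => [|k IH]; first by rewrite expr0 mul1mx.
    apply/eqP; rewrite eq_le X_ge0 andbT exprS -mulmxE -mulmxA.
    by rewrite (le_trans (XA _)) // IH.
  apply: (observable_eq0 obs) => k.
  rewrite CE mulNmx -!mulmxA mulmxDl mul1mx !mulmxDr.
  rewrite [A *m _]mulmxA mulmxE -exprS !Xker ?mulmx0 ?addr0 ?oppr0 //.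
exists X; split.
- by [].
- exact: pdmx_cmx.
- apply: psdmx_cmx => [|x].
    by rewrite linearB /= !trmx_mul trmxK Xsym mulmxA.
  have -> : qform (X - A^T *m X *m A) x = qform X x - qform X (A *m x).
    by rewrite /qform mulmxBr mulmxBl mx11B trmx_mul !mulmxA.
  by rewrite subr_ge0.
- rewrite {1}CE /b trmx_mul trmx_inv; congr (- (_ *m invmx _ *m _ *m _)).
  by rewrite linearB /= tr_scalar_mx.
Qed.
End Storage.

(** * Averages over roots of unity *)

Section RootsOfUnity.
Variable K : numClosedFieldType.

Lemma prim_root_exists N : (0 < N)%N -> exists w : K, N.-primitive_root w.
Proof.
move=> N0; pose p : {poly K} := 'X^N - 1; have [rs Dp] := closed_field_poly_normal p.
rewrite (monicP _) ?monicXnsubC // scale1r in Dp.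
have rs1 : all N.-unity_root rs by apply/allP=> z; rewrite -root_prod_XsubC -Dp.
have sz : (N < (size rs).+1)%N by rewrite -(size_prod_XsubC rs id) -Dp size_XnsubC.
have [|z] := hasP (has_prim_root N0 rs1 _ sz); last by exists z.
by rewrite -separable_prod_XsubC -Dp separable_Xn_sub_1 // pnatr_eq0 -lt0n.
Qed.

Lemma sum_prim_root N (w : K) e : (0 < N)%N -> N.-primitive_root w ->
  \sum_(t < N) (w ^+ t) ^+ e = if (N %| e)%N then N%:R else 0.
Proof.
move=> N0 wp; have we t : (w ^+ t) ^+ e = (w ^+ e) ^+ t by rewrite -!exprM mulnC.
under eq_bigr do rewrite we.
case: ifP => [dv|ndv].
  have -> : w ^+ e = 1 by apply/eqP; rewrite -(prim_order_dvd wp).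
  by under eq_bigr do rewrite expr1n; rewrite sumr_const card_ord.
have n1 : w ^+ e - 1 != 0 by rewrite subr_eq0 -(prim_order_dvd wp) ndv.
apply: (mulfI n1); rewrite mulr0 -subrX1 -exprM mulnC exprM (prim_expr_order wp).
by rewrite expr1n subrr.
Qed.

Lemma norm_prim_root N (w : K) : (0 < N)%N -> N.-primitive_root w -> `|w| = 1.
Proof.
move=> N0 wp; apply/eqP; rewrite -(pexpr_eq1 N0) // -normrX.
by rewrite (prim_expr_order wp) normr1.
Qed.

End RootsOfUnity.

Section PowerBound.
Variable K : numClosedFieldType.

(** By the theorem of Cayley and Hamilton the product of the A - z over the
    eigenvalues vanishes. Removing one factor turns the claim for V into the
    claim for (A - z) V through A^(k+1) V = z A^k V + A^k (A - z) V, and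
    |z| <= 1 < s sums the geometric series. *)
Lemma power_bound n (A : 'M[K]_n) (s : K) :
  (forall z, root (char_poly A) z -> `|z| <= 1) -> 1 < s ->
  forall i j, exists c, forall k, `|(A ^+ k) i j| <= c * s ^+ k.
Proof.
case: n A => [|n'] A rA s1; first by case.
have s10 : 0 < s - 1 by rewrite subr_gt0.
have s0 : 0 < s by rewrite (lt_trans ltr01).
have main (rs : seq K) : (forall z, z \in rs -> `|z| <= 1) ->
   forall V : 'M[K]_n'.+1, (\prod_(z <- rs) (A - z%:M)) * V = 0 ->
   forall i j, exists c, forall k, `|(A ^+ k * V) i j| <= c * s ^+ k.
  elim/last_ind: rs => [_ V|rs z IH rs1 V].
    rewrite big_nil mul1r => -> i j; exists 0 => k.
    by rewrite mulr0 mxE normr0 mul0r.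
  rewrite -cats1 big_cat big_seq1 /= -mulrA => PV i j.
  have [|c' hc'] := IH _ ((A - z%:M) * V) PV i j.
    by move=> y yr; apply: rs1; rewrite mem_rcons inE yr orbT.
  have z1 : `|z| <= 1 by apply: rs1; rewrite mem_rcons inE eqxx.
  have c'0 : 0 <= c' by have := hc' 0; rewrite expr0 mulr1; exact: le_trans.
  exists (`|V i j| + c' / (s - 1)); elim=> [|k IHk].
    by rewrite !expr0 mul1r mulr1 lerDl divr_ge0 // ltW.
  (* c is chosen so that |V i j| <= c and c + c' <= c s. *)
  have e : A ^+ k.+1 * V = z *: (A ^+ k * V) + A ^+ k * ((A - z%:M) * V).
    rewrite mulrBl mulrBr mulrA -exprSr addrC -[z%:M * V]/(z%:M *m V).
    by rewrite mul_scalar_mx scalerAr subrK.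
  rewrite e mxE (le_trans (ler_normD _ _)) // mxE normrM.
  set c := _ + _ in IHk *.
  apply: (@le_trans _ _ (c * s ^+ k + c' * s ^+ k)).
    apply: lerD; last exact: hc'.
    by rewrite (le_trans _ IHk) // ler_piMl.
  rewrite -mulrDl exprSr mulrA [c * _ * s]mulrAC; apply: ler_wpM2r.
    by rewrite exprn_ge0 // ltW.
  have -> : c * s = c + (`|V i j| * (s - 1) + c').
    by rewrite /c; field; rewrite gt_eqF.
  by rewrite lerD2l lerDr mulr_ge0 // (ltW s10).
move=> i j; have [rs Dp] := closed_field_poly_normal (char_poly A).
rewrite (monicP _) ?char_poly_monic // scale1r in Dp.
have [z zr||c hc] := main rs _ 1%:M _ i j.
- by apply: rA; rewrite Dp root_prod_XsubC.
- rewrite mulr1; have := Cayley_Hamilton A; rewrite Dp rmorph_prod => <-.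
  by apply: eq_bigr => z _; rewrite rmorphB /= horner_mx_X horner_mx_C.
by exists c => k; have := hc k; rewrite mulr1.
Qed.
End PowerBound.

Section Resolvent.
Variables (K : numClosedFieldType) (n : nat) (A : 'M[K]_n).

Lemma char_poly_at z : (char_poly A).[z] = \det (z%:M - A).
Proof.
rewrite -[LHS]/(horner_eval z (\det (char_poly_mx A))) -det_map_mx; congr (\det _).
apply/matrixP=> i j; rewrite !mxE rmorphB rmorphMn /= /horner_eval hornerX hornerC.
by [].
Qed.

Hypothesis A_stable : forall z, root (char_poly A) z -> `|z| <= 1.

Lemma resolvent_unit z : 1 < `|z| -> z%:M - A \in unitmx.
Proof.
move=> z1; rewrite unitmxE unitfE -char_poly_at; apply/negP => /A_stable h.
by move: (lt_le_trans z1 h); rewrite ltxx.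
Qed.

(** Cramer's rule: the adjugate is polynomial in z and the characteristic
    polynomial is at least (r - 1)^n in modulus. *)
Lemma resolvent_bound (r : K) : 1 < r ->
  forall i j, exists c, forall z, `|z| = r -> `|invmx (z%:M - A) i j| <= c.
Proof.
move=> r1 i j; have r0 : 0 < r by rewrite (lt_trans ltr01).
have d0 : 0 < r - 1 by rewrite subr_gt0.
pose p := \adj (char_poly_mx A) i j.
exists (((r - 1) ^+ n)^-1 * \sum_(k < size p) `|p`_k| * r ^+ k) => z zr.
have zu : z%:M - A \in unitmx by rewrite resolvent_unit // zr.
rewrite /invmx zu mxE normrM; apply: ler_pM => //.
  have det_z : \det (z%:M - A) != 0 by rewrite -unitfE -unitmxE.
  rewrite normfV lef_pV2 ?posrE ?exprn_gt0 ?normr_gt0 //.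
  rewrite -char_poly_at; have [rs Dp] := closed_field_poly_normal (char_poly A).
  rewrite (monicP _) ?char_poly_monic // scale1r in Dp.
  have szn : size rs = n.
    by have := size_char_poly A; rewrite Dp size_prod_XsubC => -[].
  have : forall y, y \in rs -> `|y| <= 1.
    by move=> y yr; apply: A_stable; rewrite Dp root_prod_XsubC.
  rewrite Dp horner_prod -szn; elim: rs {Dp szn} => [|y rs IH] rs1.
    by rewrite big_nil normr1 expr0.
  rewrite big_cons normrM exprS hornerXsubC.
  apply: ler_pM; rewrite ?exprn_ge0 ?(ltW d0) //.
    rewrite -zr (le_trans _ (lerB_dist _ _)) // lerD2l lerN2.
    by apply: rs1; rewrite mem_head.
  by apply: IH => x xr; apply: rs1; rewrite inE xr orbT.
have -> : \adj (z%:M - A) i j = p.[z].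
  have -> : z%:M - A = map_mx (horner_eval z) (char_poly_mx A).
    apply/matrixP=> k l; rewrite !mxE rmorphB rmorphMn /= /horner_eval hornerX.
    by rewrite hornerC.
  by rewrite -map_mx_adj mxE.
rewrite horner_coef (le_trans (ler_norm_sum _ _ _)) //.
by apply: ler_sum => k _; rewrite normrM normrX zr.
Qed.
End Resolvent.

Section Averaging.
Local Open Scope sesquilinear_scope.
Variable K : numClosedFieldType.
Variables (r s : K).
Hypotheses (s1 : 1 < s) (sr : s < r).

Let r1 : 1 < r := lt_trans s1 sr.
Let r0 : 0 < r := lt_trans ltr01 r1.
Let s0 : 0 < s := lt_trans ltr01 s1.
Let q := s / r.

(** Convergence at the fixed rate s / r, which all the error terms below attain;
    a common rate makes such sequences stable under sums and scalings. *)
Definition geo_cvg (a : nat -> K) (x : K) :=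
  exists c N0, forall N, (N0 <= N)%N -> `|a N - x| <= c * q ^+ N.

Lemma geo_cvgD a b x y :
  geo_cvg a x -> geo_cvg b y -> geo_cvg (fun N => a N + b N) (x + y).
Proof.
move=> [c [N1 h1]] [d [N2 h2]]; exists (c + d), (maxn N1 N2) => N.
rewrite geq_max => /andP[/h1 {}h1 /h2 {}h2].
by rewrite opprD addrACA (le_trans (ler_normD _ _)) // mulrDl lerD.
Qed.

Lemma geo_cvgZ k a x : geo_cvg a x -> geo_cvg (fun N => k * a N) (k * x).
Proof.
move=> [c [N1 h1]]; exists (`|k| * c), N1 => N /h1 h.
by rewrite -mulrBr normrM -mulrA ler_wpM2l.
Qed.

Lemma geo_cvg_conj a x : geo_cvg a x -> geo_cvg (fun N => (a N)^*) x^*.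
Proof.
move=> [c [N1 h1]]; exists c, N1 => N /h1.
by rewrite -rmorphB norm_conjC.
Qed.

Lemma geo_cvg_eq a b x : geo_cvg a x ->
  (forall N, (0 < N)%N -> a N = b N) -> geo_cvg b x.
Proof.
move=> [c [N0 h]] e; exists c, (maxn 1 N0) => N.
by rewrite geq_max => /andP[N1 /h]; rewrite e.
Qed.

Lemma geo_cvg_cst x : geo_cvg (fun=> x) x.
Proof. by exists 0, 0%N => N _; rewrite subrr normr0 mul0r. Qed.

Variable w : nat -> K.
Hypothesis w_prim : forall N, (0 < N)%N -> N.-primitive_root (w N).

Definition avg N (f : K -> K) : K := N%:R^-1 * \sum_(t < N) f (r * w N ^+ t).

Lemma avg_ext N f g : (0 < N)%N ->
  (forall z, z ^+ N = r ^+ N -> `|z| = r -> f z = g z) -> avg N f = avg N g.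
Proof.
move=> N0 e; congr (_ * _); apply: eq_bigr => t _; apply: e.
  by rewrite exprMn -exprM mulnC exprM (prim_expr_order (w_prim N0)) expr1n mulr1.
by rewrite normrM normrX (norm_prim_root N0 (w_prim N0)) expr1n mulr1 gtr0_norm.
Qed.

Lemma avgD N f g : avg N (fun z => f z + g z) = avg N f + avg N g.
Proof. by rewrite /avg big_split mulrDr. Qed.

Lemma avgZ N k f : avg N (fun z => k * f z) = k * avg N f.
Proof. by rewrite /avg -mulr_sumr mulrCA. Qed.

Lemma avg_sum N (I : finType) (f : I -> K -> K) :
  avg N (fun z => \sum_i f i z) = \sum_i avg N (f i).
Proof. by rewrite /avg exchange_big mulr_sumr. Qed.

Lemma avg_conj N f : avg N (fun z => (f z)^*) = (avg N f)^*.
Proof. by rewrite /avg rmorphM fmorphV /= rmorph_nat rmorph_sum. Qed.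

Lemma avg_ge0 N f : (0 < N)%N -> (forall z, `|z| = r -> 0 <= f z) -> 0 <= avg N f.
Proof.
move=> N0 f0; rewrite mulr_ge0 ?invr_ge0 ?ler0n // sumr_ge0 // => t _; apply: f0.
by rewrite normrM normrX (norm_prim_root N0 (w_prim N0)) expr1n mulr1 gtr0_norm.
Qed.

Lemma avg_exp N e : (0 < N)%N ->
  avg N (fun z => z ^+ e) = if (N %| e)%N then r ^+ e else 0.
Proof.
move=> N0; rewrite /avg; under eq_bigr do rewrite exprMn.
rewrite -mulr_sumr sum_prim_root ?w_prim //; case: ifP => _; last by rewrite !mulr0.
by rewrite mulrCA mulVf ?mulr1 // pnatr_eq0 -lt0n.
Qed.

Lemma avg_bound N f c : (0 < N)%N -> (forall z, `|z| = r -> `|f z| <= c) ->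
  `|avg N f| <= c.
Proof.
move=> N0 fc; rewrite normrM normfV normr_nat.
rewrite mulrC ler_pdivrMr ?ltr0n // (le_trans (ler_norm_sum _ _ _)) //.
have -> : c * N%:R = \sum_(t < N) c by rewrite sumr_const card_ord mulr_natr.
apply: ler_sum => t _; apply: fc.
by rewrite normrM normrX (norm_prim_root N0 (w_prim N0)) expr1n mulr1 gtr0_norm.
Qed.

Lemma avg_cvg0 f : (forall z, f z = 0) -> geo_cvg (fun N => avg N f) 0.
Proof.
move=> f0; apply: (geo_cvg_eq (geo_cvg_cst 0)) => N N0.
by rewrite /avg big1 ?mulr0.
Qed.

Variables (n : nat) (A : 'M[K]_n).
Hypothesis A_stable : forall z, root (char_poly A) z -> `|z| <= 1.

Definition resolv (u : 'rV[K]_n) (c : 'cV[K]_n) (z : K) : K :=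
  (u *m invmx (z%:M - A) *m c) 0 0.
Definition moment (u : 'rV[K]_n) (c : 'cV[K]_n) k : K := (u *m A ^+ k *m c) 0 0.

Lemma resDl u v c z : resolv (u + v) c z = resolv u c z + resolv v c z.
Proof. by rewrite /resolv !mulmxDl mx11D. Qed.
Lemma resDr u c d z : resolv u (c + d) z = resolv u c z + resolv u d z.
Proof. by rewrite /resolv mulmxDr mx11D. Qed.
Lemma resZl k u c z : resolv (k *: u) c z = k * resolv u c z.
Proof. by rewrite /resolv -!scalemxAl mx11Z. Qed.
Lemma resZr k u c z : resolv u (k *: c) z = k * resolv u c z.
Proof. by rewrite /resolv -scalemxAr mx11Z. Qed.

Lemma res0r u z : resolv u 0 z = 0.
Proof. by rewrite /resolv mulmx0 mxE. Qed.
Lemma res0l c z : resolv 0 c z = 0.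
Proof. by rewrite /resolv !mul0mx mxE. Qed.
Lemma mom0r u k : moment u 0 k = 0.
Proof. by rewrite /moment mulmx0 mxE. Qed.

Lemma unit_on_circle (z : K) : `|z| = r -> z%:M - A \in unitmx.
Proof. by move=> zr; apply: resolvent_unit => //; rewrite zr. Qed.

Lemma neq0_on_circle (z : K) : `|z| = r -> z != 0.
Proof. by move=> zr; rewrite -normr_gt0 zr. Qed.

(** A geometric sum of N terms for the resolvent; z^N = r^N makes the remainder
    depend on z only through the resolvent itself. *)
Lemma res_expand N u c (z : K) : z ^+ N = r ^+ N -> `|z| = r ->
  resolv u c z = (r ^+ N)^-1 *
    (\sum_(k < N) z ^+ (N.-1 - k) * moment u c k + resolv u (A ^+ N *m c) z).
Proof.
move=> zN zr; have zu := unit_on_circle zr.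
have scX k : (z%:M : 'M[K]_n) ^+ k = (z ^+ k)%:M.
  by elim: k => [//|k IH]; rewrite exprS IH -mulmxE -scalar_mxM -exprS.
have cm : GRing.comm (z%:M) A by rewrite /GRing.comm -mulmxE scalar_mxC.
have := subrXX_comm N cm; rewrite scX zN => /eqP; rewrite subr_eq => /eqP e.
have e2 : (r ^+ N) *: c = (z%:M - A) *m
    (\sum_(k < N) z ^+ (N.-1 - k) *: (A ^+ k *m c)) + A ^+ N *m c.
  rewrite -mul_scalar_mx e mulmxDl; congr (_ + _).
  rewrite -mulmxE -mulmxA; congr (_ *m _); rewrite mulmx_suml; apply: eq_bigr => k _.
  by rewrite scX mul_scalar_mx scalemxAl.
have rN : r ^+ N != 0 by rewrite expf_neq0 // gt_eqF.
apply: (mulfI rN); rewrite mulrA mulfV // mul1r -resZr e2 resDr; congr (_ + _).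
rewrite /resolv mulmxA mulmxKV // mulmx_sumr summxE; apply: eq_bigr => k _.
by rewrite -scalemxAr mx11Z mulmxA.
Qed.

Lemma mom_bound u c : exists d : K, 0 <= d /\ forall k, `|moment u c k| <= d * s ^+ k.
Proof.
have [d hd] := choice (fun ij : 'I_n * 'I_n => power_bound A_stable s1 ij.1 ij.2).
have d0 ij : 0 <= d ij.
  by have := hd ij 0; rewrite [s ^+ 0]expr0 mulr1; exact: le_trans.
exists (\sum_i \sum_j `|u 0 j| * d (j, i) * `|c i 0|); split.
  by apply: sumr_ge0 => i _; apply: sumr_ge0 => j _; rewrite !mulr_ge0.
move=> k; rewrite /moment mxE (le_trans (ler_norm_sum _ _ _)) // mulr_suml.
apply: ler_sum => i _; rewrite normrM mxE mulrC.
rewrite (le_trans (ler_wpM2l _ (ler_norm_sum _ _ _))) // mulr_sumr mulr_suml.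
apply: ler_sum => j _; rewrite normrM mulrC -!mulrA ler_wpM2l //.
by rewrite [leRHS]mulrCA [leLHS]mulrC ler_wpM2l //; exact: (hd (j, i)).
Qed.

Lemma res_bound u c : exists d : K, 0 <= d /\
  forall (z : K) N, `|z| = r -> `|resolv u (A ^+ N *m c) z| <= d * s ^+ N.
Proof.
have [d hd] := choice (fun ij : 'I_n * 'I_n => resolvent_bound A_stable r1 ij.1 ij.2).
have d0 ij : 0 <= d ij.
  apply: le_trans (hd ij r _) => //; exact: gtr0_norm.
have [e he] := choice (fun i : 'I_n => mom_bound (delta_mx 0 i) c).
exists (\sum_i \sum_j `|u 0 j| * d (j, i) * e i); split.
  by apply: sumr_ge0 => i _; apply: sumr_ge0 => j _; have [e0 _] := he i; rewrite !mulr_ge0.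
move=> z N zr; rewrite /resolv mxE (le_trans (ler_norm_sum _ _ _)) // mulr_suml.
apply: ler_sum => i _; rewrite normrM mxE mulrC.
rewrite (le_trans (ler_wpM2l _ (ler_norm_sum _ _ _))) // mulr_sumr mulr_suml.
apply: ler_sum => j _; rewrite normrM mulrC -!mulrA ler_wpM2l // ler_pM //.
  exact: (hd (j, i)).
have [_ /(_ N)] := he i; rewrite /moment -mulmxA -rowE mxE; exact.
Qed.

Lemma q_exp N : q ^+ N = s ^+ N * (r ^+ N)^-1.
Proof. by rewrite expr_div_n. Qed.

Lemma avg_res_err N u c (f : K -> K) d : (0 < N)%N -> (forall z, `|z| = r -> `|f z| <= d) ->
  forall e, 0 <= d -> (forall z, `|z| = r -> `|resolv u (A ^+ N *m c) z| <= e * s ^+ N) ->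
  `|(r ^+ N)^-1 * avg N (fun z => f z * resolv u (A ^+ N *m c) z)| <= d * e * q ^+ N.
Proof.
move=> N0 fd e d0 h; rewrite normrM q_exp.
have -> : d * e * (s ^+ N * (r ^+ N)^-1) = (r ^+ N)^-1 * (d * (e * s ^+ N)) by ring.
have ri : 0 <= (r ^+ N)^-1 by rewrite invr_ge0 exprn_ge0 // ltW.
rewrite ger0_norm // ler_wpM2l //; apply: avg_bound => // z zr.
by rewrite normrM; apply: ler_pM => //; [exact: fd | exact: h].
Qed.

(** The mean of a power of z vanishes unless N divides the exponent, so it
    selects a single term of the geometric sum. *)
Lemma avg_res_main N u c d : (d < N)%N ->
  avg N (fun z => z ^+ d.+1 * resolv u c z)
  = moment u c d + (r ^+ N)^-1 * avg N (fun z => z ^+ d.+1 * resolv u (A ^+ N *m c) z).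
Proof.
move=> dN; have N0 : (0 < N)%N by exact: leq_ltn_trans dN.
pose g z := (r ^+ N)^-1 * (\sum_(k < N) moment u c k * z ^+ (d + N - k)
   + z ^+ d.+1 * resolv u (A ^+ N *m c) z).
rewrite (@avg_ext N _ g) // => [|z zN zr]; last first.
  rewrite (res_expand _ _ zN zr) /g mulrCA mulrDr mulr_sumr; congr (_ * (_ + _)).
  apply: eq_bigr => k _; rewrite mulrA -exprD mulrC; congr (_ * _ ^+ _).
  have := ltn_ord k; lia.
rewrite avgZ avgD mulrDr avg_sum; congr (_ + _).
rewrite (bigD1 (Ordinal dN)) //= big1 ?addr0 => [|k kd].
  rewrite avgZ avg_exp // addKn dvdnn mulrC mulfK //.
  by rewrite expf_neq0 // gt_eqF.
rewrite avgZ avg_exp //; case: ifP => [dv|_]; last by rewrite mulr0.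
exfalso; move: kd; rewrite -val_eqE /= => kd; have kN := ltn_ord k.
case/dvdnP: dv => a ea.
have [a2|a1] := leqP 2 a; first by nia.
have : a = 1%N by nia.
by move=> a1'; subst a; move: ea; rewrite mul1n; lia.
Qed.

(** The mean selects one coefficient of the Laurent expansion of the resolvent
    at infinity. *)
Lemma avg_res_pos u c d :
  geo_cvg (fun N => avg N (fun z => z ^+ d.+1 * resolv u c z)) (moment u c d).
Proof.
have [e [e0 he]] := res_bound u c; exists (r ^+ d.+1 * e), d.+1 => N dN.
rewrite avg_res_main // addrAC subrr add0r.
apply: avg_res_err => [|z zr||z zr].
- exact: leq_ltn_trans dN.
- by rewrite normrX zr.
- by rewrite exprn_ge0 // ltW.
- exact: he.
Qed.

(** The Laurent expansion of the resolvent at infinity has only negative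
    powers, so multiplying by z^-j leaves no constant term. On the sample points
    z^-j is a positive power of z up to the constant r^N. *)
Lemma avg_res_neg u c j :
  geo_cvg (fun N => avg N (fun z => z ^- j * resolv u c z)) 0.
Proof.
have [e [e0 he]] := res_bound u c; have [d [d0 hd]] := mom_bound u c.
exists (d + (r ^+ j)^-1 * e), j.+1 => N jN; rewrite subr0.
have N0 : (0 < N)%N by exact: leq_ltn_trans jN.
have rN : r ^+ N != 0 by rewrite expf_neq0 // gt_eqF.
have zneg (f : K -> K) : avg N (fun z => z ^- j * f z)
    = (r ^+ N)^-1 * avg N (fun z => z ^+ (N - j.+1).+1 * f z).
  rewrite -avgZ; apply: avg_ext => // z zN zr; have z0 := neq0_on_circle zr.
  rewrite mulrA; congr (_ * _); apply: (mulfI rN).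
  rewrite mulrA mulfV // mul1r -zN subnSK // -{1}(subnK (ltnW jN)) exprD.
  by rewrite mulfK // expf_neq0.
rewrite zneg avg_res_main; last by lia.
rewrite mulrDr (le_trans (ler_normD _ _)) // [leRHS]mulrDl lerD //.
  have ri : 0 <= (r ^+ N)^-1 by rewrite invr_ge0 exprn_ge0 // ltW.
  rewrite normrM ger0_norm // q_exp mulrA [leRHS]mulrC ler_wpM2l //.
  rewrite (le_trans (hd _)) // ler_wpM2l // ler_weXn2l ?(ltW s1) //; lia.
rewrite mulrCA -zneg; apply: avg_res_err => // [z zr||z zr].
- by rewrite normfV normrX zr.
- by rewrite invr_ge0 exprn_ge0 // ltW.
- exact: he.
Qed.
End Averaging.

(** * Energies as averages over circles *)

Section SignalAverage.
Local Open Scope sesquilinear_scope.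
Variable K : numClosedFieldType.
Variables (r s : K).
Hypotheses (s1 : 1 < s) (sr : s < r).
Variable w : nat -> K.
Hypothesis w_prim : forall N, (0 < N)%N -> N.-primitive_root (w N).
Variables (m n : nat) (A : 'M[K]_n) (B : 'M[K]_(n, m)) (C : 'M[K]_(m, n)).
Hypothesis A_stable : forall z, root (char_poly A) z -> `|z| <= 1.
Implicit Types (l : seq 'cV[K]_m) (z : K).

Local Notation avg := (avg r w).
Local Notation tends := (geo_cvg r s).
Local Notation st := (state A B).
Local Notation resolv := (resolv A).

Lemma conj_circle z : `|z| = r -> z^* = r ^+ 2 / z.
Proof.
move=> zr; have z0 : z != 0 by rewrite (neq0_on_circle s1 sr zr).
by apply: (mulfI z0); rewrite -normCK zr mulrCA mulfV // mulr1.
Qed.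

(** Transform of an input, the most recent entry carrying z^0. *)
Fixpoint ztrans z l : 'cV[K]_m :=
  if l is u :: l' then u + z *: ztrans z l' else 0.

(** Complex counterpart of [energy] with s = r^2. *)
Fixpoint cenergy l : K :=
  if l is u :: l' then
    r ^+ 2 * cenergy l' +
    (u ^t* *m C *m (st l - r ^+ 2 *: st (behead l'))) 0 0
  else 0.

Lemma avg_state l k u :
  tends (fun N => avg N (fun z => z ^+ k.+1 * resolv u (B *m ztrans z l) z))
        (moment A u (st l) k).
Proof.
elim: l k => [|x l IH] k /=.
  by rewrite mom0r; apply: avg_cvg0 => z; rewrite mulmx0 res0r mulr0.
have -> : moment A u (A *m st l + B *m x) k = moment A u (B *m x) k + moment A u (st l) k.+1.
  rewrite /moment mulmxDr mx11D addrC; congr (_ + _).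
  by rewrite exprSr -mulmxE !mulmxA.
apply: (geo_cvg_eq (geo_cvgD (avg_res_pos s1 sr w_prim A_stable u (B *m x) k) (IH k.+1))).
move=> N N0; rewrite -avgD; apply: (avg_ext s1 sr w_prim) => // z _ _.
by rewrite mulmxDr resDr -scalemxAr resZr mulrDr mulrA -exprSr.
Qed.

Lemma avg_delayed_state l u :
  tends (fun N => avg N (fun z => resolv u (B *m ztrans z l) z))
        (moment A u (st (behead l)) 0).
Proof.
case: l => [|x l] /=.
  by rewrite mom0r; apply: avg_cvg0 => z; rewrite mulmx0 res0r.
rewrite -[moment _ _ _ _]add0r.
apply: (geo_cvg_eq (geo_cvgD (avg_res_neg s1 sr w_prim A_stable u (B *m x) 0)
  (avg_state l 0 u))).
move=> N N0; rewrite -avgD; apply: (avg_ext s1 sr w_prim) => // z _ _.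
by rewrite expr0 invr1 mul1r mulmxDr resDr -scalemxAr resZr expr1.
Qed.

(** Conjugation turns powers of z into powers of 1/z on the circle, so only
    negative powers of z occur. *)
Lemma avg_anticausal l k c :
  tends (fun N => avg N (fun z => z^* ^+ k * resolv ((ztrans z l) ^t* *m C) c z)) 0.
Proof.
elim: l k => [|x l IH] k /=.
  by apply: avg_cvg0 => z; rewrite trmx0 map_mx0 mul0mx res0l mulr0.
have := geo_cvgD (geo_cvgZ (r ^+ 2 ^+ k)
  (avg_res_neg s1 sr w_prim A_stable (x ^t* *m C) c k)) (IH k.+1).
rewrite mulr0 addr0 => h; apply: (geo_cvg_eq h) => N N0.
rewrite -avgZ -avgD; apply: (avg_ext s1 sr w_prim) => // z _ zr.
have -> : (x + z *: ztrans z l) ^t* = x ^t* + z^* *: (ztrans z l) ^t*.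
  by rewrite linearD /= map_mxD linearZ /= map_mxZ.
rewrite mulmxDl resDl -scalemxAl resZl mulrDr [in RHS]mulrA -exprSr; congr (_ + _).
by rewrite conj_circle // expr_div_n mulrA.
Qed.

(** On the circle z^* = r^2 / z, so the weight z - z^* turns the output into the
    difference between its next and its previous sample. The products of the
    current input with past ones give the supply of the last step, those of past
    inputs among themselves give r^2 times the energy of the tail, and the
    remaining ones are anticausal and average out. *)
Lemma avg_energy l :
  tends (fun N => avg N (fun z => (z - z^*) *
           resolv ((ztrans z l) ^t* *m C) (B *m ztrans z l) z))
        (cenergy l).
Proof.
elim: l => [|x l IH] /=.
  by apply: avg_cvg0 => z; rewrite mulmx0 res0r mulr0.
pose xC := x ^t* *m C; pose Bx := B *m x.
have c1 := avg_res_pos s1 sr w_prim A_stable xC Bx 0.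
have c2 := geo_cvgZ (- r ^+ 2) (avg_res_neg s1 sr w_prim A_stable xC Bx 1).
have c3 := avg_state l 1 xC.
have c4 := geo_cvgZ (- r ^+ 2) (avg_delayed_state l xC).
have c5 := geo_cvgZ (r ^+ 2) (avg_anticausal l 0 Bx).
have c6 := geo_cvgZ (-1) (avg_anticausal l 2 Bx).
have c7 := geo_cvgZ (r ^+ 2) IH.
have := geo_cvgD (geo_cvgD (geo_cvgD (geo_cvgD (geo_cvgD (geo_cvgD c1 c2) c3) c4) c5) c6) c7.
set lim := _ + _ => h.
have -> : r ^+ 2 * cenergy l + (x ^t* *m C *m
    (A *m st l + Bx - r ^+ 2 *: st (behead l))) 0 0 = lim.
  rewrite /lim /moment !mulr0 !addr0 mulmxBr mulmxDr mx11B mx11D -scalemxAr mx11Z.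
  rewrite -/xC expr0 !mulmx1 expr1 !mulmxA; ring.
apply: (geo_cvg_eq h) => N N0.
rewrite -!avgZ -!avgD; apply: (avg_ext s1 sr w_prim) => // z _ zr.
have z0 : z != 0 by rewrite (neq0_on_circle s1 sr zr).
have -> : (x + z *: ztrans z l) ^t* = x ^t* + z^* *: (ztrans z l) ^t*.
  by rewrite linearD /= map_mxD linearZ /= map_mxZ.
rewrite mulmxDl mulmxDr -/xC -/Bx -scalemxAl -scalemxAr.
rewrite !(resDl, resDr, resZl, resZr) conj_circle //.
by field.
Qed.
End SignalAverage.

(** * Negative imaginary functions are passive *)

Section Passivity.
Local Open Scope sesquilinear_scope.
Variable R : realType.

Lemma geo_cvg_ge0 (r s x : R) (a : nat -> R[i]) : 1 < s -> s < r ->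
  (forall N, (0 < N)%N -> 0 <= a N) -> geo_cvg r%:C%C s%:C%C a x%:C%C -> 0 <= x.
Proof.
move=> s1 sr a0 [c [N0 h]]; have r0 : 0 < r by lra.
pose q := s / r; have q0 : 0 < q by rewrite divr_gt0 //; lra.
have q1 : `|q| < 1 by rewrite gtr0_norm // ltr_pdivrMr // mul1r.
rewrite leNgt; apply/negP => x0.
have b N : (maxn 1 N0 <= N)%N -> (- x)%:C%C <= c * (q ^+ N)%:C%C.
  rewrite geq_max => /andP[N1 NN]; have := h N NN.
  have qE : s%:C%C / r%:C%C = q%:C%C by rewrite fmorph_div.
  rewrite qE -rmorphXn; apply: le_trans.
  have aN := a0 N N1; rewrite rmorphN /= ger0_norm; first by rewrite lerDr.
  by rewrite addr_ge0 // -rmorphN lecR //; lra.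
have xpos : 0 < (- x)%:C%C :> R[i] by rewrite ltcR; lra.
pose M := maxn 1 N0.
have cr : c \is Num.real.
  have := lt_le_trans xpos (b M (leqnn _)).
  rewrite pmulr_lgt0 => [/gtr0_real //|]; by rewrite ltcR exprn_gt0.
have cE := RRe_real cr.
have b' N : (M <= N)%N -> - x <= complex.Re c * q ^+ N.
  by move=> /b; rewrite -cE -rmorphM lecR.
have /cvgr0Pnorm_lt cv := cvg_expr q1.
have e0 : 0 < - x / (`|complex.Re c| + 1) by rewrite divr_gt0 ?ltr_wpDl //; lra.
have [N1 _ hN] := cv _ e0.
have := b' (maxn M N1) (leq_maxl _ _); have := hN (maxn M N1) (leq_maxr _ _).
rewrite /= ltr_pdivlMr ?ltr_wpDl // => h1 h2.
have : complex.Re c * q ^+ maxn M N1 <= `|q ^+ maxn M N1| * (`|complex.Re c| + 1).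
  rewrite mulrDr mulr1 mulrC (le_trans (ler_norm _)) // normrM lerDl //.
lra.
Qed.

Variables (m n : nat) (G : 'M[{fraction {poly R}}]_m).
Variables (A : 'M[R]_n) (B : 'M[R]_(n, m)) (C : 'M[R]_(m, n)) (D : 'M[R]_m).
Hypothesis G_sym : G^T = G.
Hypothesis G_real : realization A B C D G.
Hypothesis reach : reachable A B.
Hypothesis obs : observable A C.
Hypothesis G_NI : D_NI G.

Lemma NI_stable z : root (char_poly (cmx A)) z -> `|z| <= 1.
Proof.
rewrite /cmx -map_char_poly => rz.
have [i [j pz]] := eigenvalue_pole G_real reach obs rz.
rewrite real_leNgt ?normr_real ?real1 //; apply/negP => z1.
by have [/(_ i j z z1)[/negP]] := G_NI.
Qed.

Lemma NI_stable_at z : 1 < `|z| -> (map_poly (real_complex R) (char_poly A)).[z] != 0.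
Proof.
move=> z1; apply/negP => rz.
have /NI_stable h : root (char_poly (cmx A)) z by rewrite /cmx -map_char_poly.
by move: (lt_le_trans z1 h); rewrite ltxx.
Qed.

(** z - z^* has the sign of Im z up to the factor 2i, and the definition of a
    negative imaginary function says that i (G - G^* ) has that same sign. The
    real symmetric D cancels. *)
Lemma NI_supply_ge0 z (v : 'cV[R[i]]_m) : 1 < `|z| ->
  let g := resolv (cmx A) (v ^t* *m cmx C) (cmx B *m v) z in
  0 <= (z - z^*) * (g - g^*).
Proof.
move=> z1; have [_ /(_ z z1)] := G_NI.
have [Dsym _] := symmetric_markov G_sym G_real.
have Dh : (cmx D) ^t* = cmx D by rewrite cmx_tr -Dsym.
rewrite (mxreval_realization G_real (NI_stable_at z1)) /=.
set H := 'i *: _ => -[Hp H0 Hn] /=; set g := resolv _ _ _ _.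
have HE : (v ^t* *m H *m v) 0 0 = 'i * (g - g^*).
  rewrite /H -scalemxAr -scalemxAl mx11Z (form_antihermitian _ _ Dh).
  by rewrite /g /resolv !mulmxA.
have -> : (z - z^*) * (g - g^*) = 2 * 'Im z * (v ^t* *m H *m v) 0 0.
  rewrite HE [in RHS]ImE; have i2 : 'i * 'i = -1 :> R[i] by rewrite -expr2 sqrCi.
  have -> : 2 * ('i * (z^* - z) / 2) * ('i * (g - g^*))
     = ('i * 'i) * ((z^* - z) * (g - g^*)) by field.
  by rewrite i2 mulN1r -mulNr opprB.
have [zp|zn|z0] := real_ltgt0P (Creal_Im z).
- by rewrite mulr_ge0 ?mulr_ge0 ?(ltW zp) //; case: (Hp zp) => _; exact.
- rewrite -mulrNN mulr_ge0 //; first by rewrite -mulrN mulr_ge0 // oppr_ge0 ltW.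
  case: (Hn zn) => _ /(_ v); rewrite mulmxN mulNmx.
  by have -> (M : 'M[R[i]]_1) : (- M) 0 0 = - M 0 0 by rewrite mxE.
by rewrite z0 mulr0 mul0r.
Qed.

Lemma energy_polynomial l : exists p : {poly R}, forall s, energy A B C s l = p.[s].
Proof.
elim: l => [|w l [p IH]]; first by exists 0 => s; rewrite horner0.
exists ('X * p + (bil C w (state A B (w :: l)))%:P - (bil C w (state A B (behead l)))%:P * 'X).
move=> s; rewrite !hornerE -IH /= !bilE; ring.
Qed.

Lemma state_cmx l : state (cmx A) (cmx B) (map (@cmx R m 1) l) = cmx (state A B l).
Proof.
elim: l => [|w l IH] /=; first by rewrite /cmx map_mx0.
by rewrite IH -!cmxM /cmx map_mxD.
Qed.

Lemma cenergy_cmx (r : R) l :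
  cenergy r%:C%C (cmx A) (cmx B) (cmx C) (map (@cmx R m 1) l)
  = (energy A B C (r ^+ 2) l)%:C%C.
Proof.
elim: l => [|w l IH] //=.
rewrite IH behead_map !state_cmx cmx_tr -rmorphXn -!cmxM.
have -> : cmx (A *m state A B l) + cmx (B *m w) - (r ^+ 2)%:C%C *: cmx (state A B (behead l))
   = cmx (A *m state A B l + B *m w - r ^+ 2 *: state A B (behead l)).
  by rewrite /cmx map_mxB map_mxD map_mxZ.
by rewrite -cmxM [X in _ + X]mxE -rmorphM -rmorphD.
Qed.

(** Average [NI_supply_ge0] over a circle of radius r outside the unit disc. *)
Lemma energy_scaled_ge0 (r : R) l : 1 < r -> 0 <= energy A B C (r ^+ 2) l.
Proof.
move=> r1; pose s := (1 + r) / 2.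
have s1 : 1 < s by rewrite /s; lra.
have sr : s < r by rewrite /s; lra.
have sc1 : 1 < s%:C%C :> R[i] by rewrite ltcR.
have scr : s%:C%C < r%:C%C :> R[i] by rewrite ltcR.
have [w' w'P] := choice (fun N => prim_root_exists (R[i]) (ltn0Sn N)).
pose w N := w' N.-1.
have wP N : (0 < N)%N -> N.-primitive_root (w N).
  by move=> N0; have := w'P N.-1; rewrite prednK.
have := avg_energy sc1 scr wP (cmx B) (cmx C) NI_stable (map (@cmx R m 1) l).
set a := (fun N => _) => lim.
have lim2 := geo_cvgD lim (geo_cvg_conj lim).
rewrite cenergy_cmx in lim2.
have x2 : (energy A B C (r ^+ 2) l)%:C%C + ((energy A B C (r ^+ 2) l)%:C%C)^*
   = (energy A B C (r ^+ 2) l + energy A B C (r ^+ 2) l)%:C%C.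
  by rewrite [_^*]conj_Creal ?complex_real // -rmorphD.
rewrite x2 in lim2.
suff : 0 <= energy A B C (r ^+ 2) l + energy A B C (r ^+ 2) l by lra.
apply: (geo_cvg_ge0 s1 sr _ lim2) => N N0.
rewrite /a -avg_conj -avgD; apply: (avg_ge0 sc1 scr wP N0) => z zr.
set v := ztrans _ _; have z1 : 1 < `|z| by rewrite zr ltcR.
have := NI_supply_ge0 v z1; congr (_ <= _).
by rewrite rmorphM rmorphB /= conjCK; ring.
Qed.

(** Energies depend polynomially on the weight, so r may tend to 1. *)
Theorem NI_passive l : 0 <= energy A B C 1 l.
Proof.
have [p pE] := energy_polynomial l; rewrite leNgt; apply/negP => e0.
have p1 : 0 < - p.[1] by rewrite -pE; lra.
have [d d0 hd] := poly_cont 1 p p1.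
pose y := 1 + d / 2; have y1 : 1 < y by rewrite /y; lra.
have yd : `|y - 1| < d by rewrite /y addrAC subrr add0r gtr0_norm; lra.
have := hd y yd; rewrite -!pE ltr_norml => /andP[_].
have : 0 <= energy A B C y l.
  rewrite -[y]sqr_sqrtr; last by lra.
  by apply: energy_scaled_ge0; rewrite -sqrtr1 ltr_sqrt //; lra.
move: e0; lra.
Qed.
End Passivity.

Theorem theorem7 (R : realType) (m n : nat)
    (G : 'M[{fraction {poly R}}]_m)
    (A : 'M[R]_n) (B : 'M[R]_(n, m)) (C : 'M[R]_(m, n)) (D : 'M[R]_m)
    (G_sym : G^T = G) (G_proper : proper_rat G)
    (G_min : minimal_realization A B C D G)
    (detDA : \det (1%:M + A) != 0) (detBA : \det (1%:M - A) != 0) :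
  D_NI G <->
  D = D^T /\
  exists X : 'M[R]_n,
    [/\ X = X^T, pdmx (cmx X), psdmx (cmx (X - A^T *m X *m A))
      & C = - (B^T *m invmx (A^T - 1%:M) *m X *m (A + 1%:M))].
Proof.
have [G_real _] := G_min.
have reach := minimal_reachable G_min.
have obs := minimal_observable G_sym G_min.
split=> [NI|[Dsym [X [Xsym Xpd XQ CE]]]]; last first.
  exact: (D_NI_sufficient G_sym G_real reach obs detDA detBA Dsym Xsym Xpd XQ CE).
split; first by have [] := symmetric_markov G_sym G_real.
have passive := NI_passive G_sym G_real reach obs NI.
apply: (storage_exists reach passive obs); first exact: unit_ap1.
exact: unit_am1.
Qed.
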